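(* Let $\varphi \colon \Gamma \to \Gamma$ be a renormalization for the finitely generated group $\Gamma$, with associated Cantor action $(X_{\varphi}, \Gamma, \Phi_{\varphi})$. Let $\widehat{\varphi} \colon \widehat{\Gamma}_{\varphi} \to \widehat{\Gamma}_{\varphi}$ be the embedding induced from $\varphi$, and let $\mathcal{D}_\varphi\subset\widehat\Gamma_\varphi$ be the discriminant group. Then there exists a closed pro-nilpotent normal subgroup $\widehat{N}_{\varphi} \subset \widehat{\Gamma}_{\varphi}$ so that: (1) $\widehat{\Gamma}_{\varphi} \cong \widehat{N}_{\varphi} \rtimes \mathcal{D}_{\varphi}$ is a semi-direct product; (2) $\widehat{N}_{\varphi}$ is $\widehat{\varphi}$-invariant, and $\widehat{\varphi}$ restricts to an open contracting embedding on $\widehat{N}_{\varphi}$; (3) $\mathcal{D}_{\varphi}$ is $\widehat{\varphi}$-invariant, and $\widehat{\varphi}$ restricts to an automorphism of $\mathcal{D}_{\varphi}$. Moreover, with $\widehat{e} \in \widehat{\Gamma}_{\varphi}$ the identity element, $$\widehat{N}_{\varphi} = \{g \in \widehat{\Gamma}_{\varphi} \mid \lim_{n \to \infty} \widehat{\varphi}^{\,n}(g) = \widehat{e}\}, \qquad \mathcal{D}_{\varphi} = \bigcap_{n > 0} \widehat{\varphi}^{\,n}(\widehat{\Gamma}_{\varphi}).$$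
   Context: A renormalization of a countable group $\Gamma$ is an injective homomorphism $\varphi\colon\Gamma\to\Gamma$ whose image is a proper subgroup of finite index. Put $\Gamma_0=\Gamma$, $\Gamma_\ell=\varphi^\ell(\Gamma)$, $X_\ell=\Gamma/\Gamma_\ell$ (left cosets), and let $X_\varphi=\varprojlim X_\ell$ be the inverse limit under the natural quotient maps $X_{\ell+1}\to X_\ell$; it is a Cantor space. The left translation actions of $\Gamma$ on the $X_\ell$ induce a minimal equicontinuous action $\Phi_\varphi\colon\Gamma\to\mathrm{Homeo}(X_\varphi)$. Let $\widehat{\Gamma}_\varphi$ be the closure of $\Phi_\varphi(\Gamma)$ in $\mathrm{Homeo}(X_\varphi)$ in the uniform topology; it is a profinite group acting on $X_\varphi$. Let $x_\varphi=(e\Gamma_\ell)_{\ell\ge 0}\in X_\varphi$. The discriminant group is $\mathcal{D}_\varphi=\{\widehat g\in\widehat\Gamma_\varphi \mid \widehat g\, x_\varphi=x_\varphi\}$. When $\Gamma$ is finitely generated there is a unique continuous homomorphism $\widehat\varphi\colon\widehat\Gamma_\varphi\to\widehat\Gamma_\varphi$ with $\widehat\varphi(\Phi_\varphi(g))=\Phi_\varphi(\varphi(g))$ for all $g\in\Gamma$; it is injective with clopen image, and is the embedding induced from $\varphi$. Invariance of a subgroup $A$ means $\widehat\varphi(A)\subset A$. The semi-direct product is internal, for the given subgroups of $\widehat\Gamma_\varphi$. An endomorphism of a topological group is contracting if its iterates converge pointwise to the identity element. A profinite group is pro-nilpotent if it is an inverse limit of finite nilpotent groups. *)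

(* Defs.v *)
From HB Require Import structures.
From mathcomp Require Import all_boot all_order fingroup nilpotent.
From mathcomp Require Import all_classical topology.

Set Implicit Arguments.
Unset Strict Implicit.
Unset Printing Implicit Defensive.

Local Open Scope classical_set_scope.
Local Open Scope group_scope.

Section abstract_groups.
Variable G : groupType.
Implicit Types H N D : set G.

Definition is_subgroup H :=
  [/\ H 1, forall x y, H x -> H y -> H (x * y) & forall x, H x -> H x^-1].

Definition finitely_generated :=
  exists2 S : set G, finite_set S & smallest is_subgroup S = setT.

Definition left_coset H (g : G) : set G := [set g * h | h in H].

Definition coset_space H : Type := set_type (range (left_coset H)).

Definition to_coset H (g : G) : coset_space H :=
  SigSub (mem_set (imageT (left_coset H) g)).

Lemma translate_subproof H (a : G) (A : coset_space H) :
  [set a * b | b in set_val A] \in range (left_coset H).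
Proof.
apply/mem_set; case: A => A /= mA; rewrite set_valE /=.
have [g _ <-] := set_mem mA; exists (a * g) => //.
rewrite /left_coset eqEsubset; split => x /=.
  by move=> [h Hh <-]; exists (g * h); [exists h | rewrite mulgA].
by move=> [_ [h Hh <-] <-]; exists h => //; rewrite mulgA.
Qed.

Definition translate H (a : G) (A : coset_space H) : coset_space H :=
  SigSub (translate_subproof a A).

Lemma to_cosetP H (A : coset_space H) : exists g, A = to_coset H g.
Proof.
by have [g _ gA] := set_mem (valP A); exists g; apply: val_inj; rewrite /= gA.
Qed.

Lemma translateE H (a g : G) : translate a (to_coset H g) = to_coset H (a * g).
Proof.
apply: val_inj; rewrite /= set_valE /= /left_coset eqEsubset; split => x /=.
  by move=> [_ [h Hh <-] <-]; exists h => //; rewrite mulgA.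
by move=> [h Hh <-]; exists (g * h); [exists h | rewrite mulgA].
Qed.

Definition finite_index H := finite_set (range (left_coset H)).

Definition normal_in N (K : set G) :=
  [/\ is_subgroup N, N `<=` K & forall g n, K g -> N n -> N (n ^ g)].

Definition internal_semidirect_product (K : set G) N D :=
  [/\ normal_in N K, is_subgroup D /\ D `<=` K,
      [set n * d | n in N & d in D] = K & N `&` D = [set 1]].

End abstract_groups.

Section relative_topology.
Context {T U : topologicalType}.

Definition homeomorphism_on (A : set T) (B : set U) (f : T -> U) :=
  exists g : U -> T,
    [/\ f @` A `<=` B, g @` B `<=` A,
        {within A, continuous f} /\ {within B, continuous g},
        {in A, cancel f g} & {in B, cancel g f}].

(* f : A -> B is an open map for the subspace topologies *)
Definition open_map_on (A : set T) (B : set U) (f : T -> U) :=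
  f @` A `<=` B /\
  forall V : set T, open V ->
    exists2 W : set U, open W & f @` (V `&` A) = W `&` B.

Definition open_embedding_on (A : set T) (B : set U) (f : T -> U) :=
  open_map_on A B f /\ homeomorphism_on A (f @` A) f.

End relative_topology.

(* As for PreTopologicalNmodule in MathComp-Analysis, no compatibility of the
   two structures is required. *)
#[short(type="preTopologicalGroupType")]
HB.structure Definition PreTopologicalGroup :=
  {G of Topological G & monoid.Group G}.

Section group_endomorphisms.
Variable G : preTopologicalGroupType.
Implicit Types A : set G.

Definition endomorphism_on A (f : G -> G) :=
  [/\ f @` A `<=` A, {in A &, {morph f : x y / x * y}}
    & {within A, continuous f}].

Definition contracting_on A (f : G -> G) :=
  forall g, A g -> iter n f g @[n --> \oo] --> (1 : G).

Definition automorphism_on A (f : G -> G) :=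
  endomorphism_on A f /\ homeomorphism_on A A f.

End group_endomorphisms.

Section inverse_limits.
Context {disp : Order.disp_t} {I : porderType disp}.
Variables (T : I -> finGroupType).
Variable f : forall i j, (i <= j)%O -> T j -> T i.

Record inverse_system_of_groups : Prop := {
  index_inhabited : inhabited I;
  index_directed : forall i j : I, exists2 k, (i <= k)%O & (j <= k)%O;
  bondM : forall i j (le_ij : (i <= j)%O),
    {morph @f i j le_ij : x y / x * y};
  bond_id : forall i (le_ii : (i <= i)%O) x, f le_ii x = x;
  bond_comp : forall i j k (le_ij : (i <= j)%O) (le_jk : (j <= k)%O)
    (le_ik : (i <= k)%O) x, f le_ij (f le_jk x) = f le_ik x }.

Definition inverse_limit :
    set (prod_topology (fun i => discrete_topology (T i))) :=
  [set x | forall i j (le_ij : (i <= j)%O), f le_ij (x j) = x i].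

End inverse_limits.

Definition pro_nilpotent (G : preTopologicalGroupType) (N : set G) :=
  exists (disp : Order.disp_t) (I : porderType disp) (T : I -> finGroupType)
    (f : forall i j, (i <= j)%O -> T j -> T i),
    [/\ inverse_system_of_groups f, forall i, nilpotent [set: T i]%G
      & exists pi : forall i, G -> T i,
          (forall i, {in N &, {morph pi i : x y / x * y}}) /\
          homeomorphism_on N (inverse_limit f)
            (fun g => (fun i => pi i g)
                    : prod_topology (fun i => discrete_topology (T i)))].

Section homeomorphism_group.
Variable X : uniformType.

Definition is_homeomorphism (f : X -> X) :=
  continuous f /\
  exists g : X -> X, [/\ continuous g, cancel f g & cancel g f].

Definition Homeo : Type :=
  set_type [set f : {uniform X -> X} | is_homeomorphism f].

HB.instance Definition _ := Uniform.on Homeo.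

Definition homeo_fun (f : Homeo) : X -> X := set_val f.

Lemma homeo_funP (f : Homeo) : is_homeomorphism (homeo_fun f).
Proof. by case: f => f fP; exact: set_mem fP. Qed.

Definition mk_homeo (f : X -> X) (fP : is_homeomorphism f) : Homeo :=
  @exist _ _ (f : {uniform X -> X}) (mem_set fP).

Lemma homeo_eq (f g : Homeo) : homeo_fun f =1 homeo_fun g -> f = g.
Proof. by move=> fg; apply/val_inj/funext. Qed.

Lemma homeo_one_subproof : is_homeomorphism id.
Proof.
by split; [move=> x; exact: cvg_id | exists id; split => // x; exact: cvg_id].
Qed.

Lemma homeo_mul_subproof (f g : Homeo) :
  is_homeomorphism (homeo_fun f \o homeo_fun g).
Proof.
have [fc [f' [f'c fK f'K]]] := homeo_funP f.
have [gc [g' [g'c gK g'K]]] := homeo_funP g.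
split; first by move=> x; apply: continuous_comp; [exact: gc | exact: fc].
exists (g' \o f'); split; [|exact: can_comp|exact: can_comp].
by move=> x; apply: continuous_comp; [exact: f'c | exact: g'c].
Qed.

Definition homeo_inv_fun (f : Homeo) : X -> X :=
  projT1 (cid (homeo_funP f).2).

Lemma homeo_inv_funP (f : Homeo) :
  [/\ continuous (homeo_inv_fun f), cancel (homeo_fun f) (homeo_inv_fun f)
    & cancel (homeo_inv_fun f) (homeo_fun f)].
Proof. exact: projT2 (cid (homeo_funP f).2). Qed.

Lemma homeo_inv_subproof (f : Homeo) : is_homeomorphism (homeo_inv_fun f).
Proof.
have [? ? ?] := homeo_inv_funP f; split => //.
by exists (homeo_fun f); split => //; exact: (homeo_funP f).1.
Qed.

Definition homeo_one := mk_homeo homeo_one_subproof.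
Definition homeo_mul f g := mk_homeo (homeo_mul_subproof f g).
Definition homeo_inv f := mk_homeo (homeo_inv_subproof f).

Lemma homeo_mulA : associative homeo_mul.
Proof. by move=> f g h; exact: homeo_eq. Qed.
Lemma homeo_1mul : left_id homeo_one homeo_mul.
Proof. by move=> f; exact: homeo_eq. Qed.
Lemma homeo_mul1 : right_id homeo_one homeo_mul.
Proof. by move=> f; exact: homeo_eq. Qed.
Lemma homeo_Vmul : left_inverse homeo_one homeo_inv homeo_mul.
Proof.
by move=> f; apply: homeo_eq => x; have [_ + _] := homeo_inv_funP f; exact.
Qed.
Lemma homeo_mulV : right_inverse homeo_one homeo_inv homeo_mul.
Proof.
by move=> f; apply: homeo_eq => x; have [_ _ +] := homeo_inv_funP f; exact.
Qed.

HB.instance Definition _ := isGroup.Build Homeo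
  homeo_mulA homeo_1mul homeo_mul1 homeo_Vmul homeo_mulV.

End homeomorphism_group.

Section renormalization.
Variables (Gamma : groupType) (phi : UMagmaMorphism.type Gamma Gamma).

Definition renormalization :=
  [/\ injective phi, range phi != [set: Gamma] & finite_index (range phi)].

Definition Gamma_ (l : nat) : set Gamma := range (iter l phi).

Definition X_ (l : nat) : Type := coset_space (Gamma_ l).

Lemma Gamma_S (l : nat) : Gamma_ l.+1 `<=` Gamma_ l.
Proof. by move=> _ [x _ <-]; exists (phi x) => //; rewrite -iterSr. Qed.

Lemma Gamma_1 (l : nat) : Gamma_ l 1.
Proof. by exists 1 => //; elim: l => //= l ->; rewrite gmulf1. Qed.

Lemma Gamma_M (l : nat) x y : Gamma_ l x -> Gamma_ l y -> Gamma_ l (x * y).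
Proof.
move=> [a _ <-] [b _ <-]; exists (a * b) => //.
by elim: l => //= l ->; rewrite gmulfM.
Qed.

Lemma quotient_map_subproof l (A : X_ l.+1) :
  [set a * h | a in set_val A & h in Gamma_ l]
    \in range (left_coset (Gamma_ l)).
Proof.
apply/mem_set; case: A => A /= mA; rewrite set_valE /=.
have [g _ <-] := set_mem mA; exists g => //.
rewrite /left_coset eqEsubset; split => x /=.
  move=> [h Hh <-]; exists g; last by exists h.
  by exists 1; [exact: Gamma_1 | exact: mulg1].
move=> [_ [h /Gamma_S Hh <-]] [k Hk <-].
by exists (h * k); [exact: Gamma_M | rewrite mulgA].
Qed.

Definition quotient_map l (A : X_ l.+1) : X_ l :=
  SigSub (quotient_map_subproof A).

Lemma quotient_mapE l g :
  quotient_map (to_coset (Gamma_ l.+1) g) = to_coset (Gamma_ l) g.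
Proof.
apply: val_inj; rewrite /= set_valE /= /left_coset eqEsubset; split => x /=.
  move=> [_ [h /Gamma_S Hh <-]] [k Hk <-].
  by exists (h * k); [exact: Gamma_M | rewrite mulgA].
move=> [h Hh <-]; exists g; last by exists h.
by exists 1; [exact: Gamma_1 | exact: mulg1].
Qed.

Definition X_lim_set :
    set (prod_topology (fun l => discrete_topology (X_ l))) :=
  [set x | forall l, @quotient_map l (x l.+1) = x l].

Definition X_lim : Type := set_type X_lim_set.

HB.instance Definition _ := Uniform.on X_lim.

Lemma basepoint_subproof :
  ((fun l => to_coset (Gamma_ l) 1)
   : prod_topology (fun l => discrete_topology (X_ l))) \in X_lim_set.
Proof. by apply/mem_set => l /=; exact: quotient_mapE. Qed.

Definition basepoint : X_lim := SigSub basepoint_subproof.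

Lemma left_translation_subproof (a : Gamma) (x : X_lim) :
  ((fun l => translate a (set_val x l))
   : prod_topology (fun l => discrete_topology (X_ l))) \in X_lim_set.
Proof.
apply/mem_set => l /=; have /(_ l) /= := set_mem (valP x).
rewrite !set_valE /=; have [g ->] := to_cosetP (val x l.+1) => <-.
by rewrite quotient_mapE !translateE quotient_mapE.
Qed.

Definition left_translation (a : Gamma) (x : X_lim) : X_lim :=
  SigSub (left_translation_subproof a x).

Lemma left_translation_continuous a : continuous (left_translation a).
Proof.
apply: continuous_comp_initial => x; apply/cvg_sup.
  exact: (@fmap_filter _ _ _ (nbhs x)).
move=> l U [_ [[V oV <-] Vx] VU].
have cx : {for x, continuous (fun y : X_lim =>
    (set_val y : prod_topology (fun l => discrete_topology (X_ l))) l)}.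
  apply: (@continuous_comp _ _ _ (set_val : X_lim -> _) (@proj _ _ l)).
    exact: initial_continuous.
  exact: proj_continuous.
have : nbhs x [set y : X_lim | set_val y l = set_val x l].
  exact: cx _ (discrete_set1 _).
rewrite !nbhs_simpl /=; apply: filterS => y /= yx; apply: VU.
by move: Vx; rewrite /= !set_valE /= yx.
Qed.

Lemma left_translation_homeomorphism a : is_homeomorphism (left_translation a).
Proof.
have trK b c : b * c = 1 -> cancel (left_translation c) (left_translation b).
  move=> bc x; apply: val_inj; rewrite /= !set_valE /=.
  apply: functional_extensionality_dep => l; rewrite set_valE /=.
  have [g ->] := to_cosetP (val x l).
  by rewrite !translateE mulgA bc mul1g.
split; first exact: left_translation_continuous.
exists (left_translation a^-1); split; first exact: left_translation_continuous.
  exact/trK/mulVg.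
exact/trK/mulgV.
Qed.

Definition Phi (a : Gamma) : Homeo X_lim :=
  mk_homeo (left_translation_homeomorphism a).

Lemma PhiM : {morph Phi : a b / a * b}.
Proof.
move=> a b; apply: homeo_eq => x; apply: val_inj; rewrite /= !set_valE /=.
apply: functional_extensionality_dep => l; rewrite /= !set_valE /=.
by have [g ->] := to_cosetP (val x l); rewrite !translateE mulgA.
Qed.

Definition Gamma_hat : set (Homeo X_lim) := closure (range Phi).

Definition discriminant_group : set (Homeo X_lim) :=
  [set g | Gamma_hat g /\ homeo_fun g basepoint = basepoint].

(* Only the restriction of phi_hat to Gamma_hat is meaningful. *)
Definition induced_embedding (phi_hat : Homeo X_lim -> Homeo X_lim) :=
  endomorphism_on Gamma_hat phi_hat /\
  forall a, phi_hat (Phi a) = Phi (phi a).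

End renormalization.

Arguments X_lim {Gamma} phi.
Arguments basepoint {Gamma} phi.
Arguments Phi {Gamma} phi a.
Arguments Gamma_hat {Gamma} phi.
Arguments discriminant_group {Gamma} phi.
Arguments induced_embedding {Gamma} phi phi_hat.
Arguments renormalization {Gamma} phi.
Arguments finitely_generated : clear implicits.

(* Main.v *)
(* Write K for the closure of Gamma, f for the induced embedding and C_l for the
   kernel of the action of K on X_l.  By density, f(g) fixes the basepoint of
   X_(l+1) iff g fixes that of X_l, so f^-1(C_(l+1)) is contained in C_l, f is
   injective with image the stabilizer of the basepoint of X_1, and the
   discriminant group D is the intersection of the f^n(K).

   As Gamma is finitely generated, K has finitely many continuous homomorphisms
   to a given finite group, so by the pigeonhole principle the sequence f^k mod
   C_l is eventually periodic, uniformly on K.  Hence g is contracted by f iff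
   f^k(g) lies in C_l for all k beyond a bound depending on l only, which makes
   the contraction group N closed and normal and gives N /\ D = 1; and any
   cluster point d of f^(k!)(g) lies in D with g d^-1 in N, so that N D = K.

   Pro-nilpotency: let M run over the f-invariant open normal subgroups
   {g in N | f^k(g) in C_l for all k} of N.  The group (N /\ f^-1(M))/M is the
   kernel of the endomorphism of N/M induced by f, so its order is at most
   [N : f(N)].  This bounds the number of possible conjugation actions of K on
   these groups, hence there is a c independent of M such that f^j(N) acts
   trivially for all j >= c.  Pulling back by f^j, [N, N /\ f^-(j+1)(M)] is
   contained in f^-j(M) for j >= c, so that N/(N /\ f^-c(M)) is nilpotent, and
   the subgroups N /\ f^-c(M) shrink to 1. *)
Require Import Defs.
From HB Require Import structures.
From mathcomp Require Import all_boot all_order fingroup nilpotent.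
From mathcomp Require Import morphism quotient.
From mathcomp Require Import all_classical topology.

Set Implicit Arguments.
Unset Strict Implicit.
Unset Printing Implicit Defensive.

Local Open Scope classical_set_scope.
Local Open Scope group_scope.

(** * Cosets and finite quotients *)

Section subgroups.
Variables (G : groupType) (K Z : set G).

Lemma is_subgroupM (H : set G) x y : is_subgroup H -> H x -> H y -> H (x * y).
Proof. by move=> [_ + _]; exact. Qed.

Lemma is_subgroupV (H : set G) x : is_subgroup H -> H x -> H x^-1.
Proof. by move=> [_ _ +]; exact. Qed.

Lemma is_subgroup1 (H : set G) : is_subgroup H -> H 1.
Proof. by case. Qed.

Lemma is_subgroupJ (H : set G) x y : is_subgroup H -> H x -> H y -> H (x ^ y).
Proof.
by move=> sH Hx Hy; rewrite conjgE; do ?apply: is_subgroupM => //; exact: is_subgroupV.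
Qed.

Lemma is_subgroup_div (H : set G) x y : is_subgroup H -> H x -> H y -> H (x^-1 * y).
Proof. by move=> sH Hx Hy; apply: is_subgroupM => //; exact: is_subgroupV. Qed.

Lemma coset_sym (H : set G) x y : is_subgroup H -> H (x^-1 * y) -> H (y^-1 * x).
Proof. by move=> sH /(is_subgroupV sH); rewrite invgM invgK. Qed.

Lemma coset_trans (H : set G) y x z : is_subgroup H ->
  H (x^-1 * y) -> H (y^-1 * z) -> H (x^-1 * z).
Proof. by move=> sH xy /(is_subgroupM sH xy); rewrite -mulgA mulVKg. Qed.

Hypothesis nZ : normal_in Z K.

Let sZ : is_subgroup Z. Proof. by case: nZ. Qed.

Lemma cosetM x x' y y' : K y ->
  Z (x^-1 * x') -> Z (y^-1 * y') -> Z ((x * y)^-1 * (x' * y')).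
Proof.
move=> Ky xx yy; have [_ _ /(_ y _ Ky xx)] := nZ.
move=> /(is_subgroupM sZ)/(_ yy); rewrite conjgE invgM !mulgA.
by rewrite -(mulgA _ y) mulgV mulg1.
Qed.

Lemma cosetV x y : K x -> K x^-1 -> Z (x^-1 * y) -> Z (x^-1^-1 * y^-1).
Proof.
move=> Kx Kx' /(coset_sym sZ) xy; have [_ _ /(_ _ _ Kx' xy)] := nZ.
by rewrite conjgE !mulgA mulgK.
Qed.

Lemma cosetJ x y g : K g -> Z (x^-1 * y) -> Z ((x ^ g)^-1 * y ^ g).
Proof.
by move=> Kg xy; rewrite -conjVg -conjMg; have [_ _] := nZ; exact.
Qed.

End subgroups.

(** * Homomorphisms that are only multiplicative on a subgroup *)

Section morphism_on.
Variables (G H : groupType) (K : set G) (f : G -> H).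
Hypothesis sK : is_subgroup K.
Hypothesis fM : {in K &, {morph f : x y / x * y}}.

Lemma on_morphM x y : K x -> K y -> f (x * y) = f x * f y.
Proof. by move=> /mem_set Kx /mem_set Ky; exact: fM. Qed.

Lemma on_morph1 : f 1 = 1.
Proof.
have K1 := is_subgroup1 sK.
by apply: (mulgI (f 1)); rewrite -on_morphM // !mulg1.
Qed.

Lemma on_morphV x : K x -> f x^-1 = (f x)^-1.
Proof.
move=> Kx; apply: (mulgI (f x)).
by rewrite -on_morphM ?mulgV ?on_morph1 //; exact: is_subgroupV.
Qed.

Lemma on_morphJ x y : K x -> K y -> f (x ^ y) = f x ^ f y.
Proof.
move=> Kx Ky; have ? := is_subgroupV sK Ky; have ? := is_subgroupM sK Kx Ky.
by rewrite !conjgE !on_morphM ?on_morphV.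
Qed.

Lemma on_morph_div x y : K x -> K y -> f (x^-1 * y) = (f x)^-1 * f y.
Proof. by move=> Kx Ky; have ? := is_subgroupV sK Kx; rewrite on_morphM ?on_morphV. Qed.

End morphism_on.

Section endo_iter.
Variables (G : groupType) (K : set G) (f : G -> G).
Hypothesis fK : forall g, K g -> K (f g).
Hypothesis fM : {in K &, {morph f : x y / x * y}}.

Lemma iter_endoK n g : K g -> K (iter n f g).
Proof. by move=> Kg; elim: n => //= n; exact: fK. Qed.

Lemma iter_endoM n : {in K &, {morph iter n f : x y / x * y}}.
Proof.
move=> x y /set_mem Kx /set_mem Ky; elim: n => //= n ->.
by rewrite (on_morphM fM) //; exact: iter_endoK.
Qed.

End endo_iter.

Lemma coset_mem (G : groupType) (H : set G) x y : is_subgroup H ->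
  H (x^-1 * y) -> H y -> H x.
Proof.
move=> sH /(coset_sym sH) yx Hy.
by have := is_subgroupM sH Hy yx; rewrite mulVKg.
Qed.

Lemma coset_divg (G : groupType) (H K : set G) x y : is_subgroup K ->
  normal_in H K -> K x -> H (x^-1 * y) -> H (y * x^-1).
Proof.
move=> sK [_ _ nH] Kx xy.
have := nH _ _ (is_subgroupV sK Kx) xy.
by rewrite conjgE invgK !mulgA mulgV mul1g.
Qed.

(** For an endomorphism of a finite group, the order of the kernel equals the index of the image,
    and the labels separate the left cosets of the image. *)
Lemma card_ker_le (T : finGroupType) (psi : T -> T) (L : finType) (lab : T -> L) :
  {morph psi : x y / x * y} ->
  (forall s t, lab s = lab t -> exists u, psi u = s^-1 * t) ->
  (#|[set t | psi t == 1%g]%SET| <= #|L|)%N.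
Proof.
move=> psiM labP.
have psiM' : {in [set: T]%SET &, {morph psi : x y / x * y}} by move=> x y _ _; exact: psiM.
pose h := Morphism psiM'.
have kerE : 'ker h = [set t | psi t == 1%g]%SET.
  by apply/setP => t; rewrite !inE.
have card_im : (#|'ker h| * #|h @* [set: T]%SET| = #|[set: T]%SET|)%N.
  rewrite card_morphim finset.setIid.
  by rewrite Lagrange // finset.subsetT.
have : (#|[set: T]%SET| <= #|L| * #|h @* [set: T]%SET|)%N.
  pose rep (l : L) : T := odflt 1 [pick t | lab t == l].
  have labr t : lab (rep (lab t)) = lab t.
    by rewrite /rep; case: pickP => [s /eqP //|/(_ t)]; rewrite eqxx.
  (* [k] is injective, and its second component lies in the image of [psi], since [t] and its
     representative share a label. *)
  pose k (t : T) := (lab t, (rep (lab t))^-1 * t).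
  have kinj : injective k.
    by move=> s t [<- /mulgI].
  rewrite -(card_imset _ kinj) -cardsT -cardsX; apply: subset_leq_card.
  apply/fintype.subsetP => _ /imsetP[t _ ->]; rewrite finset.in_setX finset.in_setT /=.
  have [u <-] := labP _ _ (labr t).
  by apply/morphimP; exists u; rewrite ?finset.in_setT.
by rewrite -card_im leq_pmul2r ?cardG_gt0 // kerE.
Qed.

(** The sets [Z j] need not be subgroups: by induction each is contained in the [j]-th term of the
    upper central series. *)
Lemma nilpotent_central_chain (T : finGroupType) (Z : nat -> set T) (m : nat) :
  (forall x, Z 0%N x -> x = 1) ->
  (forall j x g, Z j.+1 x -> Z j [~ x, g]) ->
  (forall x, Z m x) -> nilpotent [set: T]%G.
Proof.
move=> Z0 ZS Zm; apply/ucnP; exists m.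
have ZsubZ j x : Z j x -> x \in 'Z_j([set: T]%G).
  elim: j x => [|j IH] x Zx; first by rewrite ucn0 (Z0 x Zx) group1.
  rewrite ucnSnR 2!inE /= gen_subG; apply/fintype.subsetP => _ /imset2P[y g + _ ->].
  by rewrite inE => /eqP ->; apply: IH; exact: ZS.
by apply/setP => x; rewrite ZsubZ ?inE.
Qed.

Lemma finite_group_of (L : finType) (mul : L -> L -> L) (one : L) (inv : L -> L) :
  associative mul -> left_id one mul -> right_id one mul ->
  left_inverse one inv mul -> right_inverse one inv mul ->
  exists (T : finGroupType) (to : L -> T) (fr : T -> L),
    [/\ cancel to fr, cancel fr to & forall x y, to (mul x y) = to x * to y].
Proof.
move=> mulA mul1 mulr1 mulV mulrV.
pose m := isGroup.Build L mulA mul1 mulr1 mulV mulrV.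
pose T := HB.pack_for finGroupType (Finite.sort L) (Finite.class L) m.
by exists T, id, id.
Qed.

(** * Finite quotients obtained from finite labellings *)

Section finite_quotients.
Variable U : Type.

Lemma finite_classes (A : set U) (R : U -> U -> Prop) (T : finType) (c : U -> T) :
  (forall u, A u -> R u u) ->
  (forall u v, A u -> A v -> R u v -> R v u) ->
  (forall u v w, A u -> A v -> A w -> R u v -> R v w -> R u w) ->
  (forall u v, A u -> A v -> c u = c v -> R u v) ->
  exists (L : finType) (cl : U -> option L) (rep : L -> U),
    [/\ forall i, A (rep i), forall i, cl (rep i) = Some i,
        forall u, A u -> exists i, cl u = Some i
      & forall u v, A u -> A v -> (cl u = cl v <-> R u v)].
Proof.
move=> R1 RV Rt cR.
pose Q u t := `[< exists2 v, A v & R u v /\ c v = t >].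
pose e u := [pick t | Q u t].
have eR u v : A u -> A v -> R u v -> e u = e v.
  move=> Au Av uv; rewrite /e; apply: eq_pick => t.
  apply/idP/idP => /asboolP[w Aw [Rw <-]]; apply/asboolP; exists w => //; split => //.
    (* The labels occurring in the class of [u] depend on that class only, so picking one of them
       gives a class invariant [e]. *)
    by apply: (Rt _ u) => //; exact: RV.
  exact: (Rt _ v).
have eS u : A u -> exists2 v, A v & R u v /\ e u = Some (c v).
  move=> Au; rewrite /e; case: pickP => [t /asboolP[v Av [uv <-]]|/(_ (c u))].
    by exists v.
  by move=> /asboolP[]; exists u => //; split => //; exact: R1.
pose L := {t : T | `[< exists2 u, A u & e u = Some t >]}.
have repP (i : L) : {u | A u /\ e u = Some (val i)}.
  by apply: cid; have [u] := asboolP _ (valP i); exists u.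
pose rep i := projT1 (repP i).
have [repA repe] : (forall i, A (rep i)) /\ forall i, e (rep i) = Some (val i).
  by split=> i; have [] := projT2 (repP i).
pose cl u : option L := obind insub (e u).
have clE u : A u -> exists2 i, cl u = Some i & e u = Some (val i).
  move=> Au; have [v Av [uv eu]] := eS u Au.
  have iP : `[< exists2 u, A u & e u = Some (c v) >].
    by apply/asboolP; exists u.
  exists (exist _ (c v) iP) => //; rewrite /cl eu /=.
  by rewrite insubT.
exists L, cl, rep; split => //.
- by move=> i; rewrite /cl repe /= valK.
- by move=> u /clE[i]; exists i.
move=> u v Au Av; split=> [|uv]; last by rewrite /cl (eR u v).
have [i -> eu] := clE u Au; have [j -> ev] := clE v Av => -[ij].
have [u' Au' [uu' eu']] := eS u Au; have [v' Av' [vv' ev']] := eS v Av.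
apply: (Rt _ u') => //; apply: (Rt _ v') => //; last exact: RV.
by apply: cR => //; move: eu'; rewrite eu ij -ev ev' => -[].
Qed.

End finite_quotients.

(** Realises [N/M] as a finite group type: the product of two classes is computed on
    representatives, and normality of [M] makes it well defined. *)
Lemma finite_quotient (G : groupType) (N M : set G) (T0 : finType) (lab : G -> T0) :
  is_subgroup N -> normal_in M N ->
  (forall x y, N x -> N y -> lab x = lab y -> M (x^-1 * y)) ->
  exists (T : finGroupType) (pi : G -> T),
    [/\ {in N &, {morph pi : x y / x * y}},
        forall x y, N x -> N y -> (pi x = pi y <-> M (x^-1 * y))
      & forall t, exists2 x, N x & pi x = t].
Proof.
move=> sN nM labP; have [sM _ _] := nM.
have [|||L [cl [rep [repN clrep clN clE]]]] :=
    @finite_classes _ N (fun x y => M (x^-1 * y)) T0 lab _ _ _ labP.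
- by move=> x _; rewrite mulVg; exact: is_subgroup1.
- by move=> x y _ _; exact: coset_sym.
- by move=> x y z _ _ _; exact: coset_trans.
have [i1 cl1] := clN _ (is_subgroup1 sN).
have N1 := is_subgroup1 sN.
(* The default [i1] is a junk value, taken only outside [N]. *)
pose p x := odflt i1 (cl x).
have pE x y : N x -> N y -> (p x = p y <-> M (x^-1 * y)).
  move=> Nx Ny; rewrite -clE // /p.
  have [i ->] := clN x Nx; have [j ->] := clN y Ny => /=.
  by split=> [->//|[]].
have prep i : p (rep i) = i by rewrite /p clrep.
pose mul i j := p (rep i * rep j).
have pM x y : N x -> N y -> p (x * y) = mul (p x) (p y).
  move=> Nx Ny; apply/pE; [exact: is_subgroupM|by apply: (is_subgroupM sN)|].
  by apply: (cosetM nM) => //; apply/pE; rewrite ?prep.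
have [|||||T [to [fr [toK frK toM]]]] :=
    @finite_group_of L mul (p 1) (fun i => p (rep i)^-1).
- move=> i j k; rewrite -(prep i) -(prep j) -(prep k).
  have NM a b : N a -> N b -> N (a * b) by exact: is_subgroupM.
  by rewrite -!pM ?mulgA //; do ?apply: NM.
- by move=> i; rewrite -{2}(prep i) -[X in mul _ X]prep -pM ?mul1g.
- by move=> i; rewrite -{2}(prep i) -[X in mul X _]prep -pM ?mulg1.
- move=> i; have Ni := is_subgroupV sN (repN i).
  by rewrite -[X in mul _ X]prep -pM // mulVg.
- move=> i; have Ni := is_subgroupV sN (repN i).
  by rewrite -[X in mul X _]prep -pM // mulgV.
exists T, (to \o p); split.
- by move=> x y /set_mem Nx /set_mem Ny /=; rewrite pM // toM.
- move=> x y Nx Ny; rewrite -pE //=; split=> [/(can_inj toK)//|->//].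
- by move=> t; exists (rep (fr t)) => //=; rewrite prep frK.
Qed.

(** * The contraction group of an open self-embedding *)

(* [C l] is a countable base of neighbourhoods of 1 in the profinite group
   [K]; the last field is sequential compactness. *)
Record filtered_profinite (G : groupType) (K : set G) (C : nat -> set G) : Prop := {
  filt_subg : is_subgroup K;
  filt_normal : forall l, normal_in (C l) K;
  filt_dec : forall l, C l.+1 `<=` C l;
  filt_sep : forall g, (forall l, C l g) -> g = 1;
  filt_fin : forall l, exists (T : finType) (lab : G -> T),
    forall g h, K g -> K h -> lab g = lab h -> C l (g^-1 * h);
  filt_cpt : forall u : nat -> G, (forall n, K (u n)) ->
    exists2 g, K g & forall l n, exists2 m, (n <= m)%N & C l (g^-1 * u m) }.

(** Closedness relative to [K] for the topology with base [C], phrased without topology so that the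
    contraction argument stays algebraic. *)
Definition filt_closed (G : groupType) (K : set G) (C : nat -> set G)
    (H : set G) :=
  forall g, K g -> (forall l, exists2 h, H h & C l (g^-1 * h)) -> H g.

(** [emb_inj] provides both injectivity and continuity of the inverse; [emb_open] makes the image
    open, as it contains [C 1]. *)
Record open_self_embedding (G : groupType) (K : set G) (C : nat -> set G)
    (f : G -> G) : Prop := {
  emb_K : forall g, K g -> K (f g);
  emb_M : {in K &, {morph f : x y / x * y}};
  emb_cont : forall l, exists m, forall g, C m g -> C l (f g);
  emb_inj : forall l g, K g -> C l.+1 (f g) -> C l g;
  emb_open : forall g, C 1%N g -> exists2 h, K h & f h = g }.

Definition filt_fg (G : groupType) (K : set G) (C : nat -> set G) :=
  exists S : seq G, {in S, forall s, K s} /\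
    forall H : set G, is_subgroup H -> filt_closed K C H ->
      {in S, forall s, H s} -> K `<=` H.

Section contraction.
Variables (G : groupType) (K : set G) (C : nat -> set G) (f : G -> G).
Hypothesis pK : filtered_profinite K C.
Hypothesis ef : open_self_embedding K C f.

Let sK := filt_subg pK.
Let fK := emb_K ef.
Let fM := emb_M ef.
Let nC := filt_normal pK.
Let sC l : is_subgroup (C l). Proof. by have [] := nC l. Qed.
Let CK l g : C l g -> K g. Proof. by have [_ + _] := nC l; exact. Qed.
Let itK n g : K g -> K (iter n f g). Proof. exact: iter_endoK. Qed.
Let CJ l g x : K g -> C l x -> C l (x ^ g).
Proof. by have [_ _] := nC l; exact. Qed.
Let itM n : {in K &, {morph iter n f : x y / x * y}}.
Proof. exact: iter_endoM. Qed.

Lemma filt_le l m g : (l <= m)%N -> C m g -> C l g.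
Proof.
elim: m => [|m IH]; first by rewrite leqn0 => /eqP ->.
by rewrite leq_eqVlt => /predU1P[-> //|lm] /(filt_dec pK); exact: IH.
Qed.

Lemma iter_emb_cont n l : exists m, forall g, C m g -> C l (iter n f g).
Proof.
elim: n l => [|n IH] l; first by exists l.
have [m Cm] := emb_cont ef l; have [p Cp] := IH m.
by exists p => g /Cp /Cm.
Qed.

Lemma iter_emb_inj n l g : K g -> C (l + n) (iter n f g) -> C l g.
Proof.
elim: n l => [|n IH] l Kg; first by rewrite addn0.
by rewrite addnS => /(emb_inj ef (itK n Kg)); exact: IH.
Qed.

Lemma emb_injective g h : K g -> K h -> f g = f h -> g = h.
Proof.
move=> Kg Kh fgh; apply/(mulgI g^-1); rewrite mulVg; apply/esym/(filt_sep pK).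
move=> l; apply: (emb_inj ef); first exact: is_subgroup_div.
by rewrite (on_morph_div sK fM) // fgh mulVg; exact: is_subgroup1.
Qed.

Hypothesis fgK : filt_fg K C.

(* The iterates of [f] modulo an open normal subgroup are determined by their
   values on a finite set of topological generators, hence eventually periodic,
   with a preperiod bounded in terms of the index only. *)
Lemma iter_mod_periodic (T : finType) : exists B, forall Z : set G,
  normal_in Z K -> (exists l, C l `<=` Z) ->
  (exists lab : G -> T, forall g h, K g -> K h -> lab g = lab h -> Z (g^-1 * h)) ->
  exists i p, [/\ (0 < p)%N, (i + p <= B)%N & forall g k, K g -> (i <= k)%N ->
    Z ((iter k f g)^-1 * iter (k + p) f g)].
Proof.
have [S [SK Sgen]] := fgK; pose n := size S.
pose B := #|{ffun 'I_n -> T}|; exists B => Z nZ [l0 CZ] [lab labZ].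
have sZ : is_subgroup Z by case: nZ.
(* [F k] records the labels of the [k]-th iterate on the generators. It takes at most [B] values on
   [B.+1] indices, so two of them collide. *)
pose F (k : 'I_B.+1) := [ffun i : 'I_n => lab (iter k f (nth 1 S i))].
have [i [j [ij Fij]]] : exists i j : 'I_B.+1, (i < j)%N /\ F i = F j.
  have /injectivePn[i [j ij Fij]] : ~~ injectiveb F.
    by apply/negP => /injectiveP /leq_card; rewrite card_ord ltnn.
  have [?|?] := ltnP i j; first by exists i, j.
  by exists j, i; split => //; rewrite ltn_neqAle eq_sym ij.
exists i, (j - i)%N; split; first by rewrite subn_gt0.
  by rewrite subnKC ?(ltnW ij) // -ltnS.
(* The elements on which two iterates agree modulo [Z] form a closed subgroup, and it contains the
   generators. *)
have key : K `<=` [set g | K g /\ Z ((iter i f g)^-1 * iter j f g)].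
  apply: Sgen.
  - split; first by split; [exact: is_subgroup1|rewrite !(on_morph1 sK (itM _)) mulVg;
      exact: is_subgroup1].
    + move=> x y [Kx Zx] [Ky Zy]; split; first exact: is_subgroupM.
      by rewrite !(on_morphM (itM _)) //; exact: (cosetM nZ (itK i Ky) Zx Zy).
    + move=> x [Kx Zx]; split; first exact: is_subgroupV.
      rewrite !(on_morphV sK (itM _)) //; apply: (cosetV nZ) => //; first exact: itK.
      by apply: is_subgroupV => //; exact: itK.
  - move=> g Kg gcl; split=> //.
    have [m1 Cm1] := iter_emb_cont i l0; have [m2 Cm2] := iter_emb_cont j l0.
    have [h [Kh Zh] gh] := gcl (maxn m1 m2).
    have /CZ Zi := Cm1 _ (filt_le (leq_maxl _ _) gh).
    have /CZ Zj := Cm2 _ (filt_le (leq_maxr _ _) gh).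
    move: Zi Zj; rewrite !(on_morph_div sK (itM _)) // => Zi /(coset_sym sZ) Zj.
    exact/(coset_trans sZ Zi)/(coset_trans sZ Zh).
  - move=> s sS; have Ks := SK s sS; split=> //.
    apply: labZ; [exact: itK|exact: itK|].
    have sn : (index s S < n)%N by rewrite index_mem.
    by move/ffunP/(_ (Ordinal sn)): Fij; rewrite !ffunE /= nth_index.
move=> g k Kg ik.
have [_] := key _ (itK (k - i) Kg).
by rewrite -!iterD subnKC // addnBA // addnC -addnBA // ltnW.
Qed.

Lemma filt_mod_periodic l : exists i p, (0 < p)%N /\
  forall g k, K g -> (i <= k)%N -> C l ((iter k f g)^-1 * iter (k + p) f g).
Proof.
have [T [lab labP]] := filt_fin pK l.
have [B /(_ (C l) (nC l))] := iter_mod_periodic T.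
case=> [||i [p [p0 _ ip]]]; [by exists l|by exists lab|by exists i, p].
Qed.

Lemma periodicM (Z : set G) i p n : is_subgroup Z ->
  (forall g k, K g -> (i <= k)%N -> Z ((iter k f g)^-1 * iter (k + p) f g)) ->
  forall g k, K g -> (i <= k)%N -> Z ((iter k f g)^-1 * iter (k + n * p) f g).
Proof.
move=> sZ ip g k Kg ik; elim: n => [|n IH].
  by rewrite addn0 mulVg; exact: is_subgroup1.
rewrite mulSnr addnA; apply: (coset_trans sZ IH); apply: ip => //.
exact: leq_trans (leq_addr _ _).
Qed.

(** * The contraction group and its complement, the core *)

Definition con : set G :=
  [set g | K g /\ forall l, exists k, forall j, (k <= j)%N -> C l (iter j f g)].

Let conK g : con g -> K g. Proof. by case. Qed.

(** From the preperiod [i] on, each iterate of [g] is congruent modulo [C l] to arbitrarily late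
    ones, which lie in [C l]. Only those late iterates depend on [g]. *)
Lemma con_uniform l : exists i, forall g, con g -> forall k, (i <= k)%N ->
  C l (iter k f g).
Proof.
have [i [p [p0 ip]]] := filt_mod_periodic l; exists i => g [Kg /(_ l)[m gm]] k ik.
apply: (coset_mem (sC l) (periodicM m (sC l) ip Kg ik)).
by apply: gm; rewrite (leq_trans (leq_pmulr _ p0)) // leq_addl.
Qed.

Lemma con_subgroup : is_subgroup con.
Proof.
split.
- split; first exact: is_subgroup1.
  move=> l; exists 0%N => j _; rewrite (on_morph1 sK (itM j)); exact: is_subgroup1.
- move=> x y [Kx cx] [Ky cy]; split; first exact: is_subgroupM.
  move=> l; have [k1 k1P] := cx l; have [k2 k2P] := cy l.
  exists (maxn k1 k2) => j; rewrite geq_max => /andP[/k1P Cx /k2P Cy].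
  by rewrite (on_morphM (itM j)) //; exact: is_subgroupM.
- move=> x [Kx cx]; split; first exact: is_subgroupV.
  move=> l; have [k kP] := cx l; exists k => j /kP Cx.
  by rewrite (on_morphV sK (itM j)) //; exact: is_subgroupV.
Qed.

Lemma con_normal : normal_in con K.
Proof.
split; [exact: con_subgroup|by move=> g []|].
move=> g n Kg [Kn cn]; split; first exact: is_subgroupJ.
move=> l; have [k kP] := cn l; exists k => j /kP Cn.
by rewrite (on_morphJ sK (itM j)) //; apply: CJ => //; exact: itK.
Qed.

(** Because the bound of [con_uniform] is common to all of [con], the approximation [h] of [g] may
    be chosen anew for each exponent [k]. *)
Lemma con_closed : filt_closed K C con.
Proof.
move=> g Kg gcl; split=> // l; have [i iP] := con_uniform l.
exists i => k ik; have [m mP] := iter_emb_cont k l.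
have [h ch gh] := gcl m; have Kh := conK ch; have := mP _ gh.
by rewrite (on_morph_div sK (itM k)) // => /coset_mem; apply => //; exact: iP.
Qed.

Lemma con_f g : K g -> con (f g) <-> con g.
Proof.
move=> Kg; split=> -[_ cg].
  split=> // l; have [k kP] := cg l; exists k.+1 => -[//|j] kj.
  by rewrite iterSr; exact: kP.
split=> [|l]; first exact: fK.
by have [k kP] := cg l; exists k => j kj; rewrite -iterSr; exact/kP/leqW.
Qed.

Lemma con_iter n g : K g -> con (iter n f g) <-> con g.
Proof. by move=> Kg; elim: n => //= n <-; apply: con_f; exact: itK. Qed.

Definition core : set G := [set g | forall n, exists2 h, K h & iter n f h = g].

Lemma coreK g : core g -> K g.
Proof. by case/(_ 0%N) => h Kh <-. Qed.

Lemma core_subgroup : is_subgroup core.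
Proof.
split.
- by move=> n; exists 1; [exact: is_subgroup1|exact: (on_morph1 sK (itM n))].
- move=> x y cx cy n; have [a Ka <-] := cx n; have [b Kb <-] := cy n.
  by exists (a * b); [exact: is_subgroupM|exact: (on_morphM (itM n))].
- move=> x cx n; have [a Ka <-] := cx n.
  by exists a^-1; [exact: is_subgroupV|exact: (on_morphV sK (itM n))].
Qed.

Lemma core_f g : core g -> core (f g).
Proof.
move=> cg n; have [h Kh <-] := cg n; exists (f h); first exact: fK.
by rewrite -iterSr.
Qed.

(** Injectivity of [f] forces the preimages of [g] obtained from all the iterates to be the same
    [h]. *)
Lemma core_fV g : core g -> exists2 h, core h & f h = g.
Proof.
move=> cg; have [h Kh fh] := cg 1%N; exists h => // n.
have [u Ku /= fu] := cg n.+1; exists u => //.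
by apply: (emb_injective); rewrite ?fu //; exact: itK.
Qed.

(** Write [g] as the [i]-th iterate of some [h], with [i] the uniform bound for [C l]. Then [h] is
    contracted too, so [g] already lies in [C l]. *)
Lemma con_core g : con g -> core g -> g = 1.
Proof.
move=> cg Dg; apply: (filt_sep pK) => l; have [i iP] := con_uniform l.
by have [h Kh hg] := Dg i; rewrite -hg; apply: iP => //; apply/(con_iter i); rewrite ?hg.
Qed.

(** Induction on [n]: an element of [C n.+1] lies in [C 1], hence in the image of [f], and [emb_inj]
    puts its preimage in [C n]. *)
Lemma filt_iter_open n g : C n g -> exists2 h, K h & iter n f h = g.
Proof.
elim: n g => [|n IH] g Cg; first by exists g => //; exact: CK Cg.
have [h Kh hg] := emb_open ef (filt_le (ltn0Sn n) Cg).
have [u Ku uh] : exists2 u, K u & iter n f u = h.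
  by apply: IH; apply: (emb_inj ef) => //; rewrite hg.
by exists u => //=; rewrite uh.
Qed.

(* Modulo [C l] the sequence [f^(k!) g] is eventually constant; its limit [d]
   is the component of [g] in the core. *)
Lemma con_core_prod g : K g -> exists2 d, core d & con (g * d^-1).
Proof.
move=> Kg; have [d Kd dP] := filt_cpt pK (fun k => itK k`! Kg).
exists d.
  (* [d] differs from an iterate of order at least [n] by an element of [C n], and both of these are
     in the image of the [n]-th iterate. *)
  move=> n; have [m nm /filt_iter_open[h Kh hd]] := dP n n.
  have nm' : (n <= m`!)%N by rewrite (leq_trans nm) ?fact_geq.
  exists (iter (m`! - n) f g * h^-1).
    by apply: is_subgroupM; [|exact: itK|exact: is_subgroupV].
  have Kh' := is_subgroupV sK Kh.
  rewrite (on_morphM (itM n)) ?(on_morphV sK (itM n)) //; last exact: itK.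
  by rewrite -iterD subnKC // hd invgM invgK mulVKg.
have Kd' := is_subgroupV sK Kd.
split; first exact: is_subgroupM.
move=> l; have [i [p [p0 ip]]] := filt_mod_periodic l; exists i => k ik.
rewrite (on_morphM (itM k)) ?(on_morphV sK (itM k)) //.
apply: (coset_divg sK (nC l)); first exact: itK.
(* Taking [m] at least [p] makes the period divide [m!], so applying [m!] further iterations changes
   nothing modulo [C l]. *)
have [m0 m0P] := iter_emb_cont k l; have [m pm dm] := dP m0 p.
have := m0P _ dm; rewrite (on_morph_div sK (itM k)) //; last exact: itK.
move/(coset_trans (sC l)); apply; apply: (coset_sym (sC l)).
rewrite -iterD -(divnK (dvdn_fact _ : p %| m`!)%N) ?p0 //.
exact: (periodicM _ (sC l) ip).
Qed.

(* [con_filt l] is an [f]-invariant open normal subgroup of [con], and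
   [con_pre l / con_filt l] is the kernel of the endomorphism induced by [f] on
   [con / con_filt l]. *)
Definition con_filt l : set G := [set g | con g /\ forall k, C l (iter k f g)].

Definition con_pre l : set G := [set g | con g /\ con_filt l (f g)].

Lemma con_filt_subgroup l : is_subgroup (con_filt l).
Proof.
split.
- split; first exact: is_subgroup1 con_subgroup.
  by move=> k; rewrite (on_morph1 sK (itM k)); exact: is_subgroup1.
- move=> x y [cx Cx] [cy Cy]; split; first exact: is_subgroupM con_subgroup _ _.
  have [Kx Ky] := (conK cx, conK cy).
  by move=> k; rewrite (on_morphM (itM k)) //; exact: is_subgroupM.
- move=> x [cx Cx]; split; first exact: is_subgroupV con_subgroup _.
  have Kx := conK cx.
  by move=> k; rewrite (on_morphV sK (itM k)) //; exact: is_subgroupV.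
Qed.

Lemma con_filt_normal l : normal_in (con_filt l) K.
Proof.
split; [exact: con_filt_subgroup|by move=> g [/conK]|].
have [_ _ nc] := con_normal.
move=> g n Kg [cn Cn]; split; first exact: nc.
have Kn := conK cn; move=> k.
by rewrite (on_morphJ sK (itM k)) //; apply: CJ => //; exact: itK.
Qed.

Lemma con_filt_f l g : con_filt l g -> con_filt l (f g).
Proof.
move=> [cg Cg]; split; first by apply/con_f => //; exact: conK.
by move=> k; rewrite -iterSr; exact: Cg.
Qed.

Lemma con_preJ l g x : K g -> con_pre l x -> con_pre l (x ^ g).
Proof.
move=> Kg [cx Cx]; have Kx := conK cx; have [_ _ nc] := con_normal.
split; first exact: nc.
rewrite (on_morphJ sK fM) //; have [_ _ nf] := con_filt_normal l.
by apply: nf => //; exact: fK.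
Qed.

(** Periodicity reduces the infinitely many conditions to those with [k < i + p], which continuity
    handles; larger [k] step back by [p]. This makes [con_filt l] open in [con]. *)
Lemma iter_open l : exists m, forall g, C m g -> forall k, C l (iter k f g).
Proof.
have [i [p [p0 ip]]] := filt_mod_periodic l.
have [m mP] : exists m, forall g, C m g -> forall k, (k < i + p)%N -> C l (iter k f g).
  elim: (i + p)%N => [|n [m mP]]; first by exists 0%N.
  have [m' m'P] := iter_emb_cont n l; exists (maxn m m') => g Cg k.
  rewrite ltnS leq_eqVlt => /predU1P[->|].
    exact/m'P/(filt_le _ Cg)/leq_maxr.
  exact/mP/(filt_le _ Cg)/leq_maxl.
exists m => g Cg k; have Kg := CK Cg.
have [n kn] := ubnP k; elim: n k kn => // n IH k kn.
have [kip|ipk] := ltnP k (i + p); first exact: mP.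
have pk : (p <= k)%N by rewrite (leq_trans _ ipk) ?leq_addl.
have : C l (iter (k - p) f g).
  apply: IH; rewrite -ltnS (leq_trans _ kn) // ltnS ltn_subrL p0.
  by rewrite (leq_trans p0).
apply: coset_mem => //; apply: (coset_sym (sC l)).
by rewrite -{2}(subnK pk); apply: ip; rewrite // leq_subRL // addnC.
Qed.

Lemma con_filt_quotient l : exists (T : finGroupType) (pi : G -> T),
  [/\ {in con &, {morph pi : x y / x * y}},
      forall x y, con x -> con y -> (pi x = pi y <-> con_filt l (x^-1 * y))
    & forall t, exists2 x, con x & pi x = t].
Proof.
have [m mP] := iter_open l; have [T0 [lab labP]] := filt_fin pK m.
apply: (@finite_quotient _ _ _ _ lab); first exact: con_subgroup.
  have [? ? nf] := con_filt_normal l.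
  by split=> // [g []//|g n /conK]; exact: nf.
move=> x y cx cy xy; split; first exact: is_subgroup_div con_subgroup _ _.
by apply: mP; apply: labP xy; exact: conK.
Qed.

(** [card_ker_le] applies to the endomorphism [psi] induced by [f] on [con / con_filt l]. Elements
    of [con] congruent modulo [C 1] differ by an element of [f(con)], so the number of labels modulo
    [C 1] bounds the kernel, whatever [l] is. *)
Lemma con_pre_index : exists q, forall l, exists lab : G -> 'I_q,
  forall x y, con_pre l x -> con_pre l y -> lab x = lab y -> con_filt l (x^-1 * y).
Proof.
have [T1 [lab1 lab1P]] := filt_fin pK 1; exists #|T1|.+1 => l.
have [T [pi [piM piE pi_onto]]] := con_filt_quotient l.
have sc := con_subgroup.
have pM x y : con x -> con y -> pi (x * y) = pi x * pi y by exact: (on_morphM piM).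
pose rep t := projT1 (cid2 (pi_onto t)).
have [repc repK] : (forall t, con (rep t)) /\ (forall t, pi (rep t) = t).
  by split=> t; rewrite /rep; case: cid2.
have cf x : con x -> con (f x) by move=> cx; apply/con_f => //; exact: conK.
pose psi t := pi (f (rep t)).
have psiE x : con x -> psi (pi x) = pi (f x).
  move=> cx; apply/piE; [exact: cf|exact: cf|].
  rewrite -(on_morph_div sK fM); [|exact: conK|exact: conK].
  by apply: con_filt_f; apply/piE => //; rewrite repK.
have psiM : {morph psi : s t / s * t}.
  move=> s t; rewrite -{1}(repK s) -{1}(repK t) -pM // psiE; last exact: is_subgroupM.
  by rewrite (on_morphM fM) ?pM //; [exact: cf|exact: cf|exact: conK|exact: conK].
have piV x : con x -> pi x^-1 = (pi x)^-1 by exact: (on_morphV sc piM).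
have ker_le : (#|[set t | psi t == 1%g]%SET| <= #|T1|)%N.
  apply: (@card_ker_le _ psi _ (lab1 \o rep)) => // s t /= st.
  have [Ks Kt] := (conK (repc s), conK (repc t)).
  have [h Kh hst] := emb_open ef (lab1P _ _ Ks Kt st).
  have ch : con h by apply/con_f => //; rewrite hst; exact: is_subgroup_div.
  exists (pi h); rewrite psiE // hst pM ?piV ?repK //; exact: is_subgroupV.
(* An element of [con_pre l] is labelled by the position of its image in an enumeration of the
   kernel of [psi]. *)
exists (fun x => inord (index (pi x) (enum [set t | psi t == 1%g]%SET))).
move=> x y [cx Cx] [cy Cy] xy; apply/piE => //.
have pre_ker z : con z -> con_filt l (f z) -> pi z \in enum [set t | psi t == 1%g]%SET.
  move=> cz Cz; rewrite mem_enum inE psiE //.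
  have <- : pi 1 = 1 := on_morph1 sc piM.
  apply/eqP/esym/piE; [exact: is_subgroup1|exact: cf|by rewrite invg1 mul1g].
apply: (index_inj 1 (pre_ker x cx Cx) (pre_ker y cy Cy)).
have lt z : (index (pi z) (enum [set t | psi t == 1%g]%SET) < #|T1|.+1)%N.
  by rewrite ltnS (leq_trans (index_size _ _)) // -cardE.
by move/(congr1 val): xy; rewrite /= !inordK.
Qed.

(* The groups [con_pre l / con_filt l] have bounded order, so that the actions
   of [K] on them by conjugation range over finitely many homomorphisms, and
   these are killed on [con] by a fixed iterate of [f]. *)
Lemma con_pre_central : exists c, forall l j g x, (c <= j)%N -> con g ->
  con_pre l x -> con_filt l (x^-1 * x ^ iter j f g).
Proof.
have [q qP] := con_pre_index.
have [B BP] := iter_mod_periodic {ffun 'I_q -> 'I_q}.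
exists B => l j g x Bj cg; have [lab labP] := qP l.
(* [Z] is the kernel of the conjugation action of [K] on [con_pre l / con_filt l]. *)
pose Z := [set g | K g /\ forall x, con_pre l x -> con_filt l (x^-1 * x ^ g)].
suff : Z (iter j f g) by case=> _; exact.
have sF := con_filt_subgroup l; have nF := con_filt_normal l.
have sZ : is_subgroup Z.
  split.
  - split=> [|y _]; first exact: is_subgroup1.
    by rewrite conjg1 mulVg; exact: is_subgroup1.
  - move=> g1 g2 [K1 Z1] [K2 Z2]; split=> [|y My]; first exact: is_subgroupM.
    rewrite conjgM; apply: (coset_trans sF (Z1 y My)).
    by apply: Z2; exact: con_preJ.
  - move=> g1 [K1 Z1]; have K1' := is_subgroupV sK K1.
    split=> [//|y My]; apply: (coset_sym sF).
    by rewrite -{2}(conjgKV g1 y); apply: Z1; exact: con_preJ.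
have nZ : normal_in Z K.
  split=> [//|g1 []//|g1 n K1 [Kn Zn]]; have K1' := is_subgroupV sK K1.
  split=> [|y My]; first exact: is_subgroupJ.
  have -> : y ^ (n ^ g1) = ((y ^ g1^-1) ^ n) ^ g1.
    by rewrite -!conjgM; congr (_ ^ _); rewrite conjgE mulgA.
  by rewrite -{1}(conjgKV g1 y); apply: (cosetJ nF) => //; apply: Zn; exact: con_preJ.
have [m mZ] : exists m, C m `<=` Z.
  have [m mP] := iter_open l; exists m => g1 C1; have K1 := CK C1.
  split=> // y [cy Cy]; have Ky := conK cy; have [_ _ nc] := con_normal.
  split; first by apply: is_subgroup_div con_subgroup _ _ => //; exact: nc.
  have Ky' := is_subgroupV sK Ky; have KJ := is_subgroupJ sK Ky K1.
  have [_ _ nCl] := nC l.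
  (* The commutator is rewritten as a conjugate of the inverse of [g1] times [g1]; all iterates of
     both factors lie in [C l]. *)
  move=> k; rewrite -commgEl commgEr (on_morphM (itM k)) ?(on_morphJ sK (itM k)) //; last 2 first.
  - exact: is_subgroupV.
  - by apply: is_subgroupJ => //; exact: is_subgroupV.
  apply: is_subgroupM => //; last exact: mP.
  apply: CJ; first exact: itK.
  rewrite (on_morphV sK (itM k)) //; apply: is_subgroupV => //; exact: mP.
have labJ (g1 g2 : G) : K g1 -> K g2 ->
    (forall a, con_pre l a -> con_filt l ((a ^ g1)^-1 * a ^ g2)) -> Z (g1^-1 * g2).
  move=> K1 K2 H; split=> [|y My]; first exact: is_subgroup_div.
  have := H _ (con_preJ (is_subgroupV sK K1) My).
  by rewrite conjgKV -conjgM.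
(* An element of [K] is determined modulo [Z] by the labels of the conjugates of these
   representatives; labels that do not occur get [1]. *)
pose rep a := if pselect (exists2 x, con_pre l x & lab x = a) is left e
  then projT1 (cid2 e) else 1.
have [|i [p [p0 ipB ip]]] := BP Z nZ (ex_intro _ m mZ).
  exists (fun g => [ffun a => lab (rep a ^ g)]) => g1 g2 K1 K2 /ffunP g12.
  apply: labJ => // y My.
  have [Mr labr] : con_pre l (rep (lab y)) /\ lab (rep (lab y)) = lab y.
    rewrite /rep; case: pselect => [e|[]]; last by exists y.
    by case: cid2.
  have ry := labP _ _ Mr My labr.
  have := g12 (lab y); rewrite !ffunE => /(labP _ _ (con_preJ K1 Mr) (con_preJ K2 Mr)) r12.
  apply: (coset_trans sF _ (coset_trans sF r12 (cosetJ nF K2 ry))).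
  exact/(coset_sym sF)/(cosetJ nF K1 ry).
(* A late iterate of [g] enters [C m], hence [Z], and periodicity modulo [Z] brings this back to the
   iterate [j]. *)
have [Kg cgm] := cg; have [n nP] := cgm m.
have ij : (i <= j)%N by rewrite (leq_trans _ Bj) // (leq_trans (leq_addr _ _) ipB).
apply: (coset_mem sZ (periodicM n sZ ip Kg ij)); apply: mZ; apply: nP.
by rewrite (leq_trans (leq_pmulr _ p0)) // leq_addl.
Qed.

(** [NN l] is the preimage of [con_filt l] under the iterate [c] of [con_pre_central]. The preimages
    under the iterates [c + j] form a central chain above it, which reaches [con] by
    [con_uniform]. *)
Lemma con_nilpotent_quotients : exists NN : nat -> set G,
  [/\ forall l, NN l.+1 `<=` NN l,
      forall l, exists m, NN m `<=` C l,
      forall l, exists m, forall g, con g -> C m g -> NN l g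
    & forall l, exists (T : finGroupType) (pi : G -> T),
      [/\ nilpotent [set: T]%G, {in con &, {morph pi : x y / x * y}},
        forall x y, con x -> con y -> (pi x = pi y <-> NN l (x^-1 * y))
      & forall t, exists2 x, con x & pi x = t]].
Proof.
have [c cP] := con_pre_central; have sc := con_subgroup.
exists (fun l => [set g | con g /\ con_filt l (iter c f g)]); split.
- move=> l g [cg [cfg Cg]]; split=> //; split=> // k; exact: (filt_dec pK (Cg k)).
- move=> l; exists (l + c)%N => g [/conK Kg [_ Fg]]; exact: (iter_emb_inj Kg (Fg 0%N)).
- move=> l; have [m mP] := iter_open l; exists m => g cg Cg; split=> //.
  split; first by apply/con_iter => //; exact: conK.
  by move=> k; rewrite -iterD; exact: mP.
move=> l; have sF := con_filt_subgroup l.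
have [_ _ nF] := con_filt_normal l; have [_ _ nc] := con_normal.
have [T0 [pi0 [_ pi0E _]]] := con_filt_quotient l.
have cit n x : con x -> con (iter n f x) by move=> cx; apply/con_iter => //; exact: conK.
pose NN : set G := [set g | con g /\ con_filt l (iter c f g)].
have [||T [pi [piM piE pi_onto]]] := @finite_quotient _ con NN _ (pi0 \o iter c f) sc.
- split=> [|g []//|g n /conK Kg [cn Fn]].
    split=> [|x y [cx Fx] [cy Fy]|x [cx Fx]]; split.
    + exact: is_subgroup1.
    + by rewrite (on_morph1 sK (itM c)); exact: is_subgroup1.
    + exact: is_subgroupM.
    + have [Kx Ky] := (conK cx, conK cy).
      by rewrite (on_morphM (itM c)) //; exact: is_subgroupM.
    + exact: is_subgroupV.
    + by have Kx := conK cx; rewrite (on_morphV sK (itM c)) //; exact: is_subgroupV.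
  split; first exact: nc.
  by have Kn := conK cn; rewrite (on_morphJ sK (itM c)) //; apply: nF => //; exact: itK.
- move=> x y cx cy /= /pi0E xy; split; first exact: is_subgroup_div.
  have [Kx Ky] := (conK cx, conK cy).
  by rewrite (on_morph_div sK (itM c)) //; apply: xy; exact: cit.
exists T, pi; split=> //.
have [i iP] := con_uniform l.
have pM x y : con x -> con y -> pi (x * y) = pi x * pi y by exact: (on_morphM piM).
have pi1 : pi 1 = 1 := on_morph1 sc piM.
have piV x : con x -> pi x^-1 = (pi x)^-1 by exact: (on_morphV sc piM).
apply: (@nilpotent_central_chain _
  (fun j => pi @` [set x | con x /\ con_filt l (iter (c + j) f x)]) i).
- move=> _ [x [cx Fx] <-]; rewrite addn0 in Fx; rewrite -pi1; apply/esym/piE => //.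
    exact: is_subgroup1.
  by rewrite invg1 mul1g.
- move=> j _ t [x [cx Fx] <-]; have [g cg <-] := pi_onto t.
  have [Kx Kg] := (conK cx, conK cg); have Kx' := is_subgroupV sK Kx.
  have cJ : con (x ^ g) by exact: nc.
  exists (x^-1 * x ^ g).
    split; first exact: is_subgroup_div.
    rewrite (on_morph_div sK (itM _)) //; last exact: conK.
    rewrite (on_morphJ sK (itM _)) //.
    (* One more iterate sends [x] into [con_filt l], so its iterate [c + j] is in [con_pre l], where
       the iterate [c + j] of [g] acts trivially. *)
    apply: cP; [exact: leq_addr|by []|split; first exact: cit].
    by rewrite -iterS -addnS.
  have cV := is_subgroupV sc cx; have cgV := is_subgroupV sc cg.
  rewrite pM // piV // commgEl; congr (_ * _).
  by rewrite !conjgE !pM ?piV //; exact: is_subgroupM.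
move=> t; have [x cx <-] := pi_onto t; exists x => //; split=> //.
split; first exact: cit.
by move=> k; rewrite -iterD; apply: iP => //; rewrite addnA leq_addl.
Qed.

End contraction.

(** * Topological form of the decomposition *)

Record filt_topology (G : preTopologicalGroupType) (K : set G)
    (C : nat -> set G) : Prop := {
  filt_top_closed : closed K;
  filt_top_sub : forall g A, K g -> nbhs g A ->
    exists l, forall h, K h -> C l (g^-1 * h) -> A h;
  filt_top_nbhs : forall g l, K g -> nbhs g [set h | K h -> C l (g^-1 * h)] }.

Section topological_contraction.
Variables (G : preTopologicalGroupType) (K : set G) (C : nat -> set G) (f : G -> G).
Hypothesis pK : filtered_profinite K C.
Hypothesis ef : open_self_embedding K C f.
Hypothesis fgK : filt_fg K C.
Hypothesis tK : filt_topology K C.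

Let sK := filt_subg pK.
Let fK := emb_K ef.
Let fM := emb_M ef.
Let nC := filt_normal pK.
Let sC l : is_subgroup (C l). Proof. by have [] := nC l. Qed.
Let CK l g : C l g -> K g. Proof. by have [_ + _] := nC l; exact. Qed.
Let N := con K C f.
Let D := core K f.
Let NK : N `<=` K. Proof. by move=> g []. Qed.
Let DK : D `<=` K. Proof. exact: coreK. Qed.
Let sN : is_subgroup N := con_subgroup pK ef.
Let sD : is_subgroup D := core_subgroup pK ef.

Lemma filt_closed_closed H : H `<=` K -> filt_closed K C H -> closed H.
Proof.
move=> HK Hcl g gH.
have Kg : K g by apply: (filt_top_closed tK); exact: closure_subset gH.
apply: Hcl => // l; have [h [Hh gh]] := gH _ (filt_top_nbhs tK l Kg).
by exists h => //; apply: gh; exact: HK.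
Qed.

Lemma within_continuous_filt (A : set G) (h : G -> G) : A `<=` K ->
  (forall g, A g -> K (h g)) ->
  (forall g l, A g -> exists m, forall x, A x -> C m (g^-1 * x) ->
     C l ((h g)^-1 * h x)) ->
  {within A, continuous h}.
Proof.
move=> AK hK hc; apply/subspace_continuousP => g Ag U /(filt_top_sub tK (hK _ Ag))[l lU].
have [m mP] := hc g l Ag.
apply: filterS (filt_top_nbhs tK m (AK _ Ag)) => x Cx Ax.
by apply: lU; [exact: hK|apply: mP => //; apply: Cx; exact: AK].
Qed.

Lemma emb_continuous (A : set G) : A `<=` K -> {within A, continuous f}.
Proof.
move=> AK; apply: within_continuous_filt => // [g /AK/fK//|g l /AK Kg].
have [m mP] := emb_cont ef l; exists m => x /AK Kx /mP.
by rewrite (on_morph_div sK fM).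
Qed.

Lemma emb_homeomorphism (A : set G) : A `<=` K -> homeomorphism_on A (f @` A) f.
Proof.
move=> AK; pose k g := if pselect (exists2 h, K h & f h = g) is left e
  then projT1 (cid2 e) else 1.
have kf h : K h -> k (f h) = h.
  move=> Kh; rewrite /k; case: pselect => [e|[]]; last by exists h.
  by case: cid2 => h' Kh' /= /(emb_injective pK ef Kh' Kh).
exists k; split => //.
- by move=> _ [_ [h Ah <-] <-]; rewrite kf //; exact: AK.
- split; first exact: emb_continuous.
  apply: within_continuous_filt => [_ [h /AK/fK Kh <-] //||].
    by move=> _ [h /AK Kh <-]; rewrite kf.
  move=> _ l [g /AK Kg <-]; exists l.+1 => _ [x /AK Kx <-].
  rewrite !kf // -(on_morph_div sK fM) //; apply: (emb_inj ef).
  exact: is_subgroup_div.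
- by move=> h /set_mem /AK /kf.
- by move=> g /set_mem[h /AK /kf + <-] => ->.
Qed.

Lemma con_invariant : f @` N `<=` N.
Proof. by move=> _ [g Ng <-]; apply/(con_f ef) => //; exact: NK. Qed.

Lemma core_image : f @` D = D.
Proof.
rewrite eqEsubset; split=> [_ [g Dg <-]|g]; first exact: (core_f ef).
by move=> /(core_fV pK ef)[h Dh <-]; exists h.
Qed.

Lemma con_open_map : open_map_on N N f.
Proof.
split=> [|V oV]; first exact: con_invariant.
(* The complement of [N] is added so that the witness can be open in the whole group while its trace
   on [N] is the image. *)
exists (interior (~` N `|` f @` (V `&` N))); first exact: open_interior.
rewrite eqEsubset; split=> [_ [g [Vg Ng] <-]|g [/interior_subset[]]//]; last first.
split; last by apply: con_invariant; exists g.
have [l lV] := filt_top_sub tK (NK Ng) (open_nbhs_nbhs (conj oV Vg)).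
apply: filterS (filt_top_nbhs tK l.+1 (fK (NK Ng))) => h Ch.
have [Nh|] := pselect (N h); [right|by left].
have [Kg Kh] := (NK Ng, NK Nh).
have [u Ku fu] := emb_open ef (filt_le pK (ltn0Sn l) (Ch Kh)).
have fgu : f (g * u) = h by rewrite (on_morphM fM) // fu mulVKg.
have Kgu : K (g * u) by exact: is_subgroupM.
exists (g * u) => //; split; last by apply/(con_f ef) => //; rewrite fgu.
by apply: lV => //; rewrite mulKg; apply: (emb_inj ef) => //; rewrite fu; exact: Ch.
Qed.

Lemma con_cvg : N = [set g | K g /\ iter n f g @[n --> \oo] --> (1 : G)].
Proof.
have K1 := is_subgroup1 sK.
rewrite eqEsubset; split=> g [Kg gP]; split=> //.
  move=> U /(filt_top_sub tK K1)[l lU]; have [k kP] := gP l.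
  exists k => // n /= /kP Cn; apply: lU; first exact: iter_endoK.
  by rewrite invg1 mul1g.
move=> l; have [k _ kP] := gP _ (filt_top_nbhs tK l K1); exists k => j kj.
by have := kP j kj; rewrite /= invg1 mul1g; apply; exact: iter_endoK.
Qed.

Lemma con_core_semidirect : internal_semidirect_product K N D.
Proof.
split; [exact: (con_normal pK ef)|by split|rewrite eqEsubset; split|].
- by move=> _ [n /NK Kn [d /DK Kd <-]]; exact: is_subgroupM.
- move=> g /(con_core_prod pK ef fgK)[d Dd Ng].
  by exists (g * d^-1) => //; exists d => //; rewrite mulgVK.
- rewrite eqEsubset; split=> [g [Ng Dg]|_ ->]; first exact: (con_core pK ef fgK).
  by split; exact: is_subgroup1.
Qed.

(** [N] is the limit of the quotients by [NN i]: a coherent family is realised by a cluster point of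
    its representatives, which stays in [N] by [con_closed]. *)
Lemma con_pro_nilpotent : pro_nilpotent N.
Proof.
have [NN [NNS NNC CNN QN]] := con_nilpotent_quotients pK ef fgK.
have NNle i j : (i <= j)%N -> NN j `<=` NN i.
  elim: j => [|j IH]; first by rewrite leqn0 => /eqP ->.
  by rewrite leq_eqVlt => /predU1P[-> //|/IH ij] g /NNS/ij.
pose T i := projT1 (cid (QN i)).
pose pi i : G -> T i := projT1 (cid (projT2 (cid (QN i)))).
have piP i : [/\ nilpotent [set: T i]%G, {in N &, {morph pi i : x y / x * y}},
    forall x y, N x -> N y -> (pi i x = pi i y <-> NN i (x^-1 * y))
  & forall t, exists2 x, N x & pi i x = t].
  exact: projT2 (cid (projT2 (cid (QN i)))).
have Tnil i : nilpotent [set: T i]%G by have [] := piP i.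
have piM i : {in N &, {morph pi i : x y / x * y}} by have [] := piP i.
have piE i x y : N x -> N y -> (pi i x = pi i y <-> NN i (x^-1 * y)).
  by have [_ _ + _] := piP i; exact.
have pi_onto i t : exists2 x, N x & pi i x = t by have [_ _ _] := piP i; exact.
pose rep i t := projT1 (cid2 (pi_onto i t)).
have repN i t : N (rep i t) by rewrite /rep; case: cid2.
have repK i t : pi i (rep i t) = t by rewrite /rep; case: cid2.
pose bond i j (_ : (i <= j)%O) (t : T j) : T i := pi i (rep j t).
have bond_pi i j (ij : (i <= j)%O) x : N x -> bond i j ij (pi j x) = pi i x.
  by move=> Nx; apply/piE => //; apply: (NNle i j ij); apply/piE; rewrite ?repK.
have lim_pi x : inverse_limit bond x -> exists2 g, N g & forall i, pi i g = x i.
  move=> lx; have [g Kg gP] := filt_cpt pK (fun n => NK (repN n (x n))).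
  have Ng : N g.
    apply: (con_closed pK ef fgK) => // l; have [m _ Cm] := gP l 0%N.
    by exists (rep m (x m)); [exact: repN|exact: Cm].
  exists g => // i; have [l lP] := CNN i; have [m im Cm] := gP l i.
  rewrite -(lx i m im) -[x m]repK bond_pi //; apply/piE => //.
  exact: lP (is_subgroup_div sN Ng (repN _ _)) Cm.
pose k x := if pselect (exists2 g, N g & forall i, pi i g = x i) is left e
  then projT1 (cid2 e) else 1.
have kP x : inverse_limit bond x -> N (k x) /\ forall i, pi i (k x) = x i.
  move=> /lim_pi e; rewrite /k; case: pselect => [{}e|//].
  by case: cid2.
have sep g h : N g -> N h -> (forall i, pi i g = pi i h) -> g = h.
  move=> Ng Nh gh; apply: (mulgI g^-1); rewrite mulVg; apply/esym/(filt_sep pK).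
  by move=> l; have [m] := NNC l; apply; apply/piE.
exists _, nat, T, bond; split => //.
  split.
  - exact: (inhabits 0%N).
  - by move=> i j; exists (maxn i j); [exact: leq_maxl|exact: leq_maxr].
  - move=> i j ij s t; rewrite -{1}(repK _ s) -{1}(repK _ t).
    rewrite -(on_morphM (piM j)) // bond_pi ?(on_morphM (piM i)) //.
    exact: is_subgroupM.
  - by move=> i ii t; rewrite -{1}(repK _ t) bond_pi // repK.
  - by move=> i j l ij jl il t; rewrite -(repK _ t) !bond_pi.
exists pi; split=> //; exists k; split.
- by move=> _ [g Ng <-] i j ij; exact: bond_pi.
- by move=> _ [x /kP[Nk _] <-].
- split.
    apply/subspace_continuousP => g Ng; apply/cvg_sup.
    move=> i U [_ [[V oV <-] Vg] VU].
    have [l lP] := CNN i.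
    apply: filterS (filt_top_nbhs tK l (NK Ng)) => h Ch Nh; apply: VU.
    have gh : pi i g = pi i h.
      apply/piE => //; apply: lP; first exact: is_subgroup_div.
      exact/Ch/NK.
    by have : V (pi i g) by []; rewrite gh.
  apply/subspace_continuousP => x lx U; have [Nk kx] := kP x lx.
  move=> /(filt_top_sub tK (NK Nk))[l lU]; have [m mP] := NNC l.
  have : nbhs x [set y | y m = x m].
    exact: (@proj_continuous _ _ m x) _ (discrete_set1 _).
  apply: filterS => y yx ly; have [Nky ky] := kP y ly.
  apply: lU; first exact: NK.
  by apply: mP; apply/piE => //; rewrite kx ky.
- move=> g /set_mem Ng; have [|Nk ki] := kP (fun i => pi i g).
    by move=> i j ij; exact: bond_pi.
  exact: sep.
- move=> x /set_mem /kP[_ kx]; apply: functional_extensionality_dep => i.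
  exact: kx.
Qed.

End topological_contraction.

(** * The closure of Gamma in the homeomorphism group *)

Lemma seq_nat_bounded (T : eqType) (s : seq T) (g : T -> nat) :
  exists l, forall i, i \in s -> (g i <= l)%N.
Proof.
by exists (\max_(i <- s) g i)%N => i iS; exact: leq_bigmax_seq.
Qed.

Lemma sup_entourage (T : choiceType) (I : Type) (Tc : I -> Uniform T) (i : I)
    (E : set (T * T)) :
  @entourage (Uniform.Pack (Tc i)) E -> @entourage (sup_topology Tc) E.
Proof.
move=> entE; have entE' : `[< @entourage (Uniform.Pack (Tc i)) E >].
  exact/asboolP.
exists E => //.
pose ie : {p : ({classic I} * set (T * T))%type |
  `[< @entourage (Uniform.Pack (Tc p.1)) p.2 >]} := exist _ (i, E) entE'.
have := @finI_from1 _ _ [set: {p : ({classic I} * set (T * T))%type | `[< @entourage (Uniform.Pack (Tc p.1)) p.2 >]}] (fun p => (projT1 p).2) ie Logic.I.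
exact.
Qed.

(** * Coordinates on the Cantor space and neighbourhoods of homeomorphisms *)

Section cantor_action.
Variables (Gamma : groupType) (phi : UMagmaMorphism.type Gamma Gamma).
Notation X := (X_lim phi).
Notation Gamma_ := (Gamma_ phi).

Definition coord (l : nat) (x : X) : X_ phi l := set_val x l.

Lemma coord_inj (x y : X) : (forall l, coord l x = coord l y) -> x = y.
Proof.
move=> xy; apply/val_inj/functional_extensionality_dep => l; exact: xy.
Qed.

Lemma coordS l (x : X) : quotient_map (coord l.+1 x) = coord l x.
Proof. by have /(_ l) := set_mem (valP x). Qed.

Lemma coord_le l m (x y : X) : (l <= m)%N ->
  coord m x = coord m y -> coord l x = coord l y.
Proof.
elim: m => [|m IH]; first by rewrite leqn0 => /eqP ->.
rewrite leq_eqVlt => /predU1P[-> //|lm] xy; apply: IH => //.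
by rewrite -(coordS m x) xy coordS.
Qed.

Lemma coord_translation l a (x : X) :
  coord l (left_translation a x) = translate a (coord l x).
Proof. by rewrite /coord !set_valE /= !set_valE. Qed.

(** A basic entourage constrains finitely many coordinates, and each coordinate determines all lower
    ones, so the largest index suffices. *)
Lemma X_entourageP (E : set (X * X)) :
  entourage E <-> exists l, forall x y, coord l x = coord l y -> E (x, y).
Proof.
split.
  move=> [V [W [S finS <-] WV] VE].
  have [l Sl] := @seq_nat_bounded _ (finmap.enum_fset S) (fun i => (projT1 i).1).
  exists l => x y xy; apply: VE; apply: WV => i /= iS.
  have {xy} : coord (projT1 i).1 x = coord (projT1 i).1 y.
    by apply: coord_le xy; exact: Sl.
  case: i {iS} => [[k W'] /= /asboolP [A /= dA AW]] xy.
  apply: AW; apply: dA; exists (coord k x) => //=.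
  by rewrite /unstable.map_pair /= {2}xy.
move=> [l lE].
exists [set xy | xy.1 l = xy.2 l]; last by move=> [x y] /= xy; exact: lE.
have entl : entourage ([set xy | xy.1 l = xy.2 l] :
    set (initial_topology (@proj _ (fun l => discrete_topology (X_ phi l)) l) * 
     initial_topology (@proj _ (fun l => discrete_topology (X_ phi l)) l))).
  by exists [set z | z.1 = z.2]; [move=> _ [x _ <-] | move=> -[]].
exact: (@sup_entourage _ nat (fun i => Uniform.class (initial_topology
  (@proj _ (fun l => discrete_topology (X_ phi l)) i))) l _ entl).
Qed.

Definition agree l (g h : Homeo X) :=
  forall x, coord l (homeo_fun g x) = coord l (homeo_fun h x).

Lemma Homeo_nbhsP (g : Homeo X) (A : set (Homeo X)) :
  nbhs g A <-> exists l, forall h, agree l g h -> A h.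
Proof.
split.
  rewrite -nbhs_entourageE => -[U [V entV VU] UA].
  move: entV; rewrite uniform_entourage => -[E /X_entourageP[l lE] EV].
  exists l => h gh; apply: UA; apply/mem_set; apply: VU; apply: EV => x _ /=.
  by apply: lE; exact: gh.
move=> [l lA]; rewrite -nbhs_entourageE.
exists [set gh | agree l gh.1 gh.2]; last by move=> h /set_mem; exact: lA.
exists [set gh | forall x, coord l (gh.1 x) = coord l (gh.2 x)]; last by [].
rewrite uniform_entourage; exists [set xy | coord l xy.1 = coord l xy.2].
  by apply/X_entourageP; exists l.
by move=> fg /= fgl x; exact: fgl.
Qed.

Lemma continuous_coordP (f : X -> X) :
  continuous f <-> forall x l, exists m, forall y,
    coord m x = coord m y -> coord l (f x) = coord l (f y).
Proof.
split=> fc x.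
  move=> l; have : nbhs (f x) [set y | coord l (f x) = coord l y].
    rewrite -nbhs_entourageE; exists [set xy | coord l xy.1 = coord l xy.2].
      by apply/X_entourageP; exists l.
    by move=> y /set_mem.
  move/(fc x); rewrite nbhs_filterE -nbhs_entourageE => -[U /X_entourageP[m mU] UA].
  by exists m => y xy; apply: UA; apply/mem_set; exact: mU.
move=> A; rewrite -nbhs_entourageE => -[U /X_entourageP[l lU] UA].
have [m fm] := fc x l.
rewrite nbhs_filterE.
exists [set xy | coord m xy.1 = coord m xy.2]; first by apply/X_entourageP; exists m.
by move=> y /set_mem /fm xy; apply: UA; apply/mem_set; exact: lU.
Qed.

End cantor_action.

Lemma to_coset_eq (G : groupType) (H : set G) a b : is_subgroup H ->
  to_coset H a = to_coset H b <-> H (a^-1 * b).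
Proof.
move=> sH; split=> [/(congr1 val) /= ab|ab].
  have : left_coset H b b by exists 1; [exact: is_subgroup1|exact: mulg1].
  by rewrite -ab => -[h Hh <-]; rewrite mulKg.
apply: val_inj; rewrite /= eqEsubset; split=> _ [h Hh <-].
  exists ((a^-1 * b)^-1 * h); first exact: is_subgroup_div.
  by rewrite invgM invgK !mulgA mulgV mul1g.
by exists (a^-1 * b * h); [exact: is_subgroupM|rewrite !mulgA mulgV mul1g].
Qed.

Lemma translateM (G : groupType) (H : set G) a b (A : coset_space H) :
  translate a (translate b A) = translate (a * b) A.
Proof. by have [g ->] := to_cosetP A; rewrite !translateE mulgA. Qed.

Lemma translate1 (G : groupType) (H : set G) (A : coset_space H) : translate 1 A = A.
Proof. by have [g ->] := to_cosetP A; rewrite translateE mul1g. Qed.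

Definition finitely_many_cosets (G : groupType) (H : set G) :=
  exists (T : finType) (lab : G -> T), forall a b, lab a = lab b -> H (a^-1 * b).

Lemma finite_index_cosets (G : groupType) (H : set G) :
  is_subgroup H -> finite_index H -> finitely_many_cosets H.
Proof.
move=> sH /finite_seqP[s sE].
have mem a : left_coset H a \in s.
  by have : [set` s] (left_coset H a) by rewrite -sE; exists a.
exists 'I_(size s).+1, (fun a => inord (index (left_coset H a) s)) => a b.
move=> /(congr1 val); rewrite /= !inordK ?ltnS ?index_size // => ab.
apply/(to_coset_eq _ _ sH)/val_inj => /=.
exact: (index_inj (left_coset H a) (mem a) (mem b)).
Qed.

Section Gamma_l.
Variables (Gamma : groupType) (phi : UMagmaMorphism.type Gamma Gamma).
Hypothesis phi_inj : injective phi.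
Hypothesis phi_fin : finite_index (range phi).

Lemma Gamma_subgroup l : is_subgroup (Gamma_ phi l).
Proof.
split; [exact: Gamma_1|exact: Gamma_M|move=> _ [a _ <-]].
exists a^-1 => //; elim: l => //= l ->; exact: gmulfV.
Qed.

Lemma Gamma_phi l a : Gamma_ phi l.+1 (phi a) <-> Gamma_ phi l a.
Proof.
split=> [[b _ /= /phi_inj <-]|[b _ <-]]; first by exists b.
by exists b.
Qed.

(** An element is labelled by its coset modulo [range phi], together with the label at level [l] of
    the element [u] that [phi] sends to its quotient by the coset representative. *)
Lemma Gamma_finite l : finitely_many_cosets (Gamma_ phi l).
Proof.
elim: l => [|l [Tl [labl IH]]].
  by exists unit, (fun=> tt) => a b _; exists (a^-1 * b).
have [T1 [lab1 lab1P]] : finitely_many_cosets (range phi).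
  exact: (@finite_index_cosets _ _ (Gamma_subgroup 1)).
have repP t : {a | (exists b, lab1 b = t) -> lab1 a = t}.
  apply: cid; have [[b bt]|nb] := pselect (exists b, lab1 b = t).
    by exists b.
  by exists 1 => /nb.
pose rep t := projT1 (repP t).
have lab_rep a : lab1 (rep (lab1 a)) = lab1 a.
  by apply: (projT2 (repP (lab1 a))); exists a.
have phiV a : {u | phi u = (rep (lab1 a))^-1 * a}.
  by apply: cid; have [u _ <-] := lab1P _ _ (lab_rep a); exists u.
exists (T1 * Tl)%type, (fun a => (lab1 a, labl (projT1 (phiV a)))) => a b [].
case: (phiV a) => u /= ua; case: (phiV b) => v /= vb ab uv.
have -> : a^-1 * b = phi (u^-1 * v).
  by rewrite gmulfM gmulfV ua vb ab invgM invgK -mulgA mulVKg.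
exact/Gamma_phi/IH.
Qed.

End Gamma_l.

(** * The closure of the action as a profinite group *)

Section Gamma_hat_structure.
Variables (Gamma : groupType) (phi : UMagmaMorphism.type Gamma Gamma).
Hypothesis phi_inj : injective phi.
Hypothesis phi_fin : finite_index (range phi).
Notation X := (X_lim phi).
Notation K := (Gamma_hat phi).
Notation Phi := (Phi phi).

Let sG l : is_subgroup (Gamma_ phi l) := Gamma_subgroup phi l.

Lemma coord_Phi l a (x : X) : coord l (homeo_fun (Phi a) x) = translate a (coord l x).
Proof. exact: coord_translation. Qed.

Lemma coord_basepoint l : coord l (basepoint phi) = to_coset (Gamma_ phi l) 1.
Proof. by rewrite /coord set_valE. Qed.

Lemma coord_Phi_basepoint l a :
  coord l (homeo_fun (Phi a) (basepoint phi)) = to_coset (Gamma_ phi l) a.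
Proof. by rewrite coord_Phi coord_basepoint translateE mulg1. Qed.

Lemma coord_surj l (x : X) :
  exists a, coord l x = coord l (homeo_fun (Phi a) (basepoint phi)).
Proof.
by have [a xa] := to_cosetP (coord l x); exists a; rewrite coord_Phi_basepoint.
Qed.

Lemma agree_le l m (g h : Homeo X) : (l <= m)%N -> agree m g h -> agree l g h.
Proof. by move=> lm gh x; apply: coord_le lm _; exact: gh. Qed.

Lemma agree_sym l (g h : Homeo X) : agree l g h -> agree l h g.
Proof. by move=> gh x; rewrite gh. Qed.

Lemma agree_trans l (h g k : Homeo X) : agree l g h -> agree l h k -> agree l g k.
Proof. by move=> gh hk x; rewrite gh. Qed.

Lemma agree_eq (g h : Homeo X) : (forall l, agree l g h) -> g = h.
Proof. by move=> gh; apply: homeo_eq => x; apply: coord_inj => l; exact: gh. Qed.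

Lemma Gamma_hatP g : K g <-> forall l, exists a, agree l g (Phi a).
Proof.
split=> [Kg l|gP A /Homeo_nbhsP[l lA]].
  have [|_ [[a _ <-] ga]] := Kg [set h | agree l g h]; last by exists a.
  by apply/Homeo_nbhsP; exists l.
by have [a ga] := gP l; exists (Phi a); split; [exists a|exact: lA].
Qed.

Lemma Phi_Gamma_hat a : K (Phi a).
Proof. by apply/Gamma_hatP => l; exists a. Qed.

Lemma coord_homeo l g (x y : X) : K g ->
  coord l x = coord l y -> coord l (homeo_fun g x) = coord l (homeo_fun g y).
Proof. by move=> /Gamma_hatP/(_ l)[a ga] xy; rewrite !ga !coord_Phi xy. Qed.

Lemma homeo_mulE (g h : Homeo X) x : homeo_fun (g * h) x = homeo_fun g (homeo_fun h x).
Proof. by []. Qed.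

Lemma homeo_1E (x : X) : homeo_fun 1 x = x.
Proof. by []. Qed.

Lemma homeo_VK (g : Homeo X) x : homeo_fun g^-1 (homeo_fun g x) = x.
Proof. by rewrite -homeo_mulE mulVg. Qed.

Lemma homeo_KV (g : Homeo X) x : homeo_fun g (homeo_fun g^-1 x) = x.
Proof. by rewrite -homeo_mulE mulgV. Qed.

Lemma Phi1 : Phi 1 = 1.
Proof. by apply: agree_eq => l x; rewrite coord_Phi translate1. Qed.

Lemma PhiV a : Phi a^-1 = (Phi a)^-1.
Proof. by apply: (mulgI (Phi a)); rewrite -PhiM !mulgV Phi1. Qed.

Lemma Gamma_hat_subgroup : is_subgroup K.
Proof.
split.
- by rewrite -Phi1; exact: Phi_Gamma_hat.
- move=> g h /Gamma_hatP gP /Gamma_hatP hP; apply/Gamma_hatP => l.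
  have [a ga] := gP l; have [b hb] := hP l; exists (a * b) => x.
  by rewrite homeo_mulE ga coord_Phi hb !coord_Phi translateM.
- move=> g /Gamma_hatP gP; apply/Gamma_hatP => l.
  have [a ga] := gP l; exists a^-1 => x.
  rewrite coord_Phi -{2}(homeo_KV g x) ga coord_Phi translateM mulVg.
  by rewrite translate1.
Qed.

Let sK := Gamma_hat_subgroup.

Definition level_kernel l : set (Homeo X) := [set g | K g /\ agree l g 1].

Lemma level_kernel_agree l g h : K g -> K h ->
  level_kernel l (g^-1 * h) <-> agree l g h.
Proof.
move=> Kg Kh; split=> [[_ gh] x|gh].
  have /(coord_homeo Kg) := gh x.
  by rewrite homeo_mulE homeo_KV homeo_1E => ->.
split=> [|x]; first exact: (is_subgroup_div sK Kg Kh).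
rewrite homeo_mulE homeo_1E -[in RHS](homeo_VK g x).
by apply: coord_homeo; [exact: (is_subgroupV sK)|rewrite gh].
Qed.

Lemma level_kernel_normal l : normal_in (level_kernel l) K.
Proof.
split; [split|by move=> g []|].
- by split=> //; exact: (is_subgroup1 sK).
- move=> g h [Kg g1] [Kh h1]; split=> [|x]; first exact: (is_subgroupM sK).
  by rewrite homeo_mulE g1 !homeo_1E h1.
- move=> g [Kg g1]; have Kg' := is_subgroupV sK Kg; split=> // x.
  by rewrite homeo_1E -[in RHS](homeo_KV g x) g1.
- move=> g n Kg [Kn n1]; split=> [|x]; first exact: (is_subgroupJ sK).
  rewrite conjgE !homeo_mulE homeo_1E -[in RHS](homeo_VK g x).
  by apply: coord_homeo; [exact: (is_subgroupV sK)|exact: n1].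
Qed.

Lemma level_kernel_fin l : exists (T : finType) (lab : Homeo X -> T),
  forall g h, K g -> K h -> lab g = lab h -> level_kernel l (g^-1 * h).
Proof.
have [T [lab labP]] := Gamma_finite phi_inj phi_fin l.
pose xi (x : X) := lab (projT1 (cid (to_cosetP (coord l x)))).
have xiP x y : xi x = xi y -> coord l x = coord l y.
  rewrite /xi; case: cid => a /= ->; case: cid => b /= -> /labP ab.
  exact/to_coset_eq.
have repP t : {x | (exists y, xi y = t) -> xi x = t}.
  apply: cid; have [[x xt]|nx] := pselect (exists y, xi y = t).
    by exists x.
  by exists (basepoint phi) => /nx.
pose rep t := projT1 (repP t).
have rep_xi x : coord l (rep (xi x)) = coord l x.
  by apply: xiP; apply: (projT2 (repP (xi x))); exists x.
exists {ffun T -> T}, (fun g => [ffun t => xi (homeo_fun g (rep t))]).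
move=> g h Kg Kh /ffunP gh; apply/level_kernel_agree => // x.
rewrite -(coord_homeo Kg (rep_xi x)) -(coord_homeo Kh (rep_xi x)).
by apply: xiP; have := gh (xi x); rewrite !ffunE.
Qed.

Lemma lim_point (p : forall l, X_ phi l) :
  (forall l, quotient_map (p l.+1) = p l) -> exists x : X, forall l, coord l x = p l.
Proof.
move=> pP; have pX : (p : prod_topology (fun l => discrete_topology (X_ phi l)))
    \in @X_lim_set Gamma phi by exact: mem_set.
by exists (SigSub pX) => l; rewrite /coord set_valE.
Qed.

(** The limit is defined coordinatewise, its [l]-th coordinate being that of [h l]; the inverses are
    coherent as well and yield its inverse. *)
Lemma Gamma_hat_complete (h : nat -> Homeo X) : (forall l, K (h l)) ->
  (forall l, agree l (h l.+1) (h l)) -> exists2 g, K g & forall l, agree l g (h l).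
Proof.
move=> Kh hS; have KhV l := is_subgroupV sK (Kh l).
have lim (u : nat -> Homeo X) : (forall l, agree l (u l.+1) (u l)) ->
    exists g : X -> X, forall x l, coord l (g x) = coord l (homeo_fun (u l) x).
  move=> uS; have /choice[g gP] : forall x : X, exists y : X, forall l,
      coord l y = coord l (homeo_fun (u l) x).
    by move=> x; apply: lim_point => l; rewrite coordS uS.
  by exists g.
have [g gP] := lim h hS.
have [|k kP] := lim (fun l => (h l)^-1).
  move=> l x; rewrite -{1}(homeo_KV (h l) x).
  set y := homeo_fun (h l)^-1 x.
  rewrite -[in RHS](homeo_VK (h l.+1) y); apply: coord_homeo => //.
  by rewrite hS.
have gc : continuous g.
  by apply/continuous_coordP => x l; exists l => y xy; rewrite !gP; exact: coord_homeo.
have kc : continuous k.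
  by apply/continuous_coordP => x l; exists l => y xy; rewrite !kP; exact: coord_homeo.
have gH : is_homeomorphism g.
  split=> //; exists k; split=> // x; apply: coord_inj => l.
    by rewrite kP (coord_homeo (KhV l) (gP x l)) homeo_VK.
  by rewrite gP (coord_homeo (Kh l) (kP x l)) homeo_KV.
have gh l : agree l (mk_homeo gH) (h l) by move=> x; rewrite -gP.
exists (mk_homeo gH) => //; apply/Gamma_hatP => l.
have /Gamma_hatP/(_ l)[a ha] := Kh l; exists a; exact: agree_trans (gh l) ha.
Qed.

(** An ultrafilter of indices selects one class at each level; two selected sets meet, so the
    classes are coherent and [Gamma_hat_complete] applies. *)
Lemma Gamma_hat_cpt (u : nat -> Homeo X) : (forall n, K (u n)) ->
  exists2 g, K g & forall l n, exists2 m, (n <= m)%N & level_kernel l (g^-1 * u m).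
Proof.
move=> Ku; have [F [FU ooF]] := ultraFilterLemma eventually_filter.
have pick l : exists h, K h /\ F [set n | agree l h (u n)].
  have [T [lab labP]] := level_kernel_fin l.
  have [t Ft] : exists t, F [set n | lab (u n) = t].
    apply: contrapT => nt.
    have : \forall n \near F, forall t, lab (u n) <> t.
      apply: filter_forall => t; have [Ft|//] := in_ultra_setVsetC [set n | lab (u n) = t] FU.
      by case: nt; exists t.
    by move=> /filter_ex[n /(_ (lab (u n)))].
  have [n nt] := filter_ex Ft; exists (u n); split=> //.
  apply: filterS Ft => m mt; apply/level_kernel_agree => //; apply: labP => //.
  by rewrite nt mt.
have [h hP] := choice pick.
have Kh l : K (h l) by have [] := hP l.
have [|g Kg gh] := Gamma_hat_complete Kh.
  move=> l; have [_ Fl] := hP l; have [_ Fl'] := hP l.+1.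
  have [n [nl nl']] := filter_ex (filterI Fl Fl').
  exact: agree_trans (agree_le (leqnSn l) nl') (agree_sym nl).
exists g => // l n; have [_ Fl] := hP l.
have Fn : F [set m | (n <= m)%N] by apply: ooF; exists n.
have [m [nm hm]] := filter_ex (filterI Fn Fl); exists m => //.
by apply/level_kernel_agree => //; exact: agree_trans (gh l) hm.
Qed.

Lemma Gamma_hat_profinite : filtered_profinite K level_kernel.
Proof.
split.
- exact: Gamma_hat_subgroup.
- exact: level_kernel_normal.
- by move=> l g [Kg g1]; split=> //; exact: agree_le (leqnSn l) g1.
- by move=> g gC; apply: agree_eq => l; have [] := gC l.
- exact: level_kernel_fin.
- exact: Gamma_hat_cpt.
Qed.

Lemma Gamma_hat_topology : filt_topology K level_kernel.
Proof.
split.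
- exact: closed_closure.
- move=> g A Kg /Homeo_nbhsP[l lA]; exists l => h Kh /level_kernel_agree gh.
  exact/lA/gh.
- move=> g l Kg; apply/Homeo_nbhsP; exists l => h gh Kh.
  exact/level_kernel_agree.
Qed.

Lemma Gamma_hat_fg : finitely_generated Gamma -> filt_fg K level_kernel.
Proof.
move=> [S /finite_seqP[s ->] Sgen]; exists [seq Phi a | a <- s]; split.
  by move=> _ /mapP[a _ ->]; exact: Phi_Gamma_hat.
move=> H sH clH sHs g Kg; apply: clH => // l.
have /Gamma_hatP/(_ l)[a ga] := Kg; exists (Phi a); last first.
  by apply/level_kernel_agree => //; exact: Phi_Gamma_hat.
have : [set: Gamma] a by [].
rewrite -Sgen => /(_ [set b | H (Phi b)]); apply; split.
  split=> [|b c Hb Hc|b Hb] /=.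
  - by rewrite Phi1; exact: is_subgroup1.
  - by rewrite PhiM; exact: is_subgroupM.
  - by rewrite PhiV; exact: is_subgroupV.
by move=> b /= bs; apply: sHs; exact: map_f.
Qed.

(** * The induced embedding and the discriminant group *)

Section induced.
Variable phi_hat : Homeo X -> Homeo X.
Hypothesis indK : induced_embedding phi phi_hat.
Notation f := phi_hat.

Let fK g : K g -> K (f g).
Proof. by move=> Kg; have [[fK _ _] _] := indK; apply: fK; exists g. Qed.

Let fM : {in K &, {morph f : x y / x * y}}.
Proof. by have [[]] := indK. Qed.

Let fPhi a : f (Phi a) = Phi (phi a).
Proof. by have [_] := indK. Qed.

Lemma induced_continuous g l : K g ->
  exists m, forall h, K h -> agree m g h -> agree l (f g) (f h).
Proof.
move=> Kg; have [[_ _ /subspace_continuousP fc] _] := indK.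
have : nbhs (f g) [set h | agree l (f g) h] by apply/Homeo_nbhsP; exists l.
by move=> /(fc g Kg) /Homeo_nbhsP[m mP]; exists m => h Kh gh; exact: mP.
Qed.

(* The stabilizer of the [l]-th coordinate of the basepoint, i.e. the closure
   of [Gamma_ l]. *)
Definition stab l (g : Homeo X) :=
  coord l (homeo_fun g (basepoint phi)) = coord l (basepoint phi).

Lemma stab_Phi l a : stab l (Phi a) <-> Gamma_ phi l a.
Proof.
rewrite /stab coord_Phi_basepoint coord_basepoint.
split=> [/esym|a1]; last apply/esym.
  by rewrite to_coset_eq // invg1 mul1g.
by rewrite to_coset_eq // invg1 mul1g.
Qed.

Lemma stab_agree l g h : agree l g h -> stab l g -> stab l h.
Proof. by rewrite /stab => ->. Qed.

Lemma stab_induced l g : K g -> stab l.+1 (f g) <-> stab l g.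
Proof.
move=> Kg; have [m mP] := induced_continuous l.+1 Kg.
have /Gamma_hatP/(_ (maxn m l))[a ga] := Kg.
have fga : agree l.+1 (f g) (Phi (phi a)).
  rewrite -fPhi; apply: mP; first exact: Phi_Gamma_hat.
  exact: agree_le (leq_maxl _ _) ga.
have gal : agree l g (Phi a) := agree_le (leq_maxr _ _) ga.
split=> [/(stab_agree fga)/stab_Phi/(Gamma_phi phi_inj)/stab_Phi|].
  exact/stab_agree/agree_sym.
move=> /(stab_agree gal)/stab_Phi/(Gamma_phi phi_inj)/stab_Phi.
exact/stab_agree/agree_sym.
Qed.

Lemma stab1_induced g : K g -> stab 1%N g -> exists2 h, K h & f h = g.
Proof.
move=> Kg g1; have /Gamma_hatP gP := Kg.
(* Level [m.+1] is at least 1, so the approximating element of [Gamma] lies in [range phi]. A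
   cluster point of the [Phi (b m)] is then the preimage. *)
have /choice[b bP] : forall m, exists b, agree m.+1 g (Phi (phi b)).
  move=> m; have [a ga] := gP m.+1.
  have /stab_Phi[b _ /= ba] := stab_agree (agree_le (ltn0Sn m) ga) g1.
  by exists b; rewrite ba.
have [h Kh hP] := Gamma_hat_cpt (fun m => @Phi_Gamma_hat (b m)).
exists h => //; apply: agree_eq => l; have [m mP] := induced_continuous l Kh.
have [n ln hn] := hP m l.
have Kb := @Phi_Gamma_hat (b n).
have {}hn : agree m h (Phi (b n)) by apply/level_kernel_agree.
apply: agree_trans (mP _ Kb hn) _; rewrite fPhi; apply: agree_sym.
exact: agree_le (leqW ln) (bP n).
Qed.

Lemma induced_open_self_embedding : open_self_embedding K level_kernel f.
Proof.
split.
- exact: fK.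
- exact: fM.
- move=> l; have [m mP] := induced_continuous l (is_subgroup1 sK).
  exists m => g [Kg g1]; split; first exact: fK.
  have := mP g Kg (agree_sym g1); rewrite (on_morph1 sK fM).
  exact: agree_sym.
(* Conjugation by [Phi a] moves the question from [x] to the basepoint, where [stab_induced]
   applies. *)
- move=> l g Kg [_ fg1]; split=> // x; have [a xa] := coord_surj l x.
  have Ka := @Phi_Gamma_hat a; have KVa := is_subgroupV sK Ka.
  have : stab l (g ^ Phi a).
    apply/stab_induced; first exact: (is_subgroupJ sK).
    rewrite (on_morphJ sK fM) // /stab conjgE !homeo_mulE.
    have KVf := is_subgroupV sK (fK Ka).
    by rewrite (coord_homeo KVf (fg1 _)) homeo_1E homeo_VK.
  rewrite /stab conjgE !homeo_mulE => /(coord_homeo Ka).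
  by rewrite homeo_KV homeo_1E (coord_homeo Kg xa) -xa.
- move=> g [Kg g1]; apply: stab1_induced => //; exact: g1.
Qed.

Lemma discriminant_core : discriminant_group phi = core K f.
Proof.
rewrite eqEsubset; split=> [g [Kg gx] n|g Dg].
  have : stab n g by rewrite /stab gx.
  elim: n g Kg {gx} => [|n IH] g Kg gn; first by exists g.
  have [h Kh hg] := stab1_induced Kg (coord_le (ltn0Sn n) gn).
  have [|k Kk kh] := IH h Kh; first by apply/stab_induced; rewrite ?hg.
  by exists k => //=; rewrite kh.
have [h Kh hg] := Dg 0%N; split; first by rewrite -hg.
apply: coord_inj => n; have [k Kk <-] := Dg n.
rewrite -/(stab n (iter n f k)).
elim: n => [|n IH] /=; last by apply/stab_induced => //; exact: (iter_endoK fK).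
have [a ka] := coord_surj 0 (homeo_fun k (basepoint phi)).
by rewrite /stab ka; apply/stab_Phi; exists a.
Qed.

End induced.

End Gamma_hat_structure.

Theorem theorem5p3 (Gamma : groupType) (phi : UMagmaMorphism.type Gamma Gamma)
    (phi_hat : Homeo (X_lim phi) -> Homeo (X_lim phi)) :
  finitely_generated Gamma ->
  renormalization phi ->
  induced_embedding phi phi_hat ->
  exists N_hat : set (Homeo (X_lim phi)),
    [/\ [/\ normal_in N_hat (Gamma_hat phi), closed N_hat
          & pro_nilpotent N_hat],
        internal_semidirect_product (Gamma_hat phi) N_hat
          (discriminant_group phi),
        [/\ phi_hat @` N_hat `<=` N_hat,
            open_embedding_on N_hat N_hat phi_hat
          & contracting_on N_hat phi_hat],
        phi_hat @` discriminant_group phi `<=` discriminant_group phi /\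
        automorphism_on (discriminant_group phi) phi_hat
      & N_hat = [set g | Gamma_hat phi g /\
                         iter n phi_hat g @[n --> \oo]
                           --> (1 : Homeo (X_lim phi))] /\
        discriminant_group phi =
          \bigcap_(n in [set n | (0 < n)%N]) (iter n phi_hat @` Gamma_hat phi)].
Proof.
move=> fgG [phi_inj _ phi_fin] ind.
have pK := Gamma_hat_profinite phi_inj phi_fin.
have tK := Gamma_hat_topology phi.
have fgK := Gamma_hat_fg phi fgG.
have ef := induced_open_self_embedding phi_inj phi_fin ind.
have [[fK fM _] _] := ind.
set K := Gamma_hat phi; set C := level_kernel (phi := phi).
have NK : con K C phi_hat `<=` K by move=> g [].
have DK : core K phi_hat `<=` K := @coreK _ K phi_hat.
have imD := core_image pK ef.
have Ncvg := con_cvg pK ef tK.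
rewrite (discriminant_core phi_inj phi_fin ind).
exists (con K C phi_hat); split.
- split; [exact: (con_normal pK ef)| |exact: (con_pro_nilpotent pK ef fgK tK)].
  exact: (filt_closed_closed tK NK (con_closed pK ef fgK)).
- exact: (con_core_semidirect pK ef fgK).
- split; first exact: (con_invariant ef).
    split; [exact: (con_open_map pK ef tK)|exact: (emb_homeomorphism pK ef tK)].
  by move=> g; rewrite Ncvg => -[].
- split; first by rewrite imD.
  split; last by have := emb_homeomorphism pK ef tK DK; rewrite imD.
  split; [by rewrite imD| |exact: (emb_continuous pK ef tK)].
  by move=> x y /set_mem/DK/mem_set Kx /set_mem/DK/mem_set Ky; exact: fM.
- split=> //; rewrite eqEsubset; split=> g.
    by move=> Dg n _; have [h Kh <-] := Dg n; exists h.
  (* [core] includes the exponent 0 while the intersection starts at 1; since [f] preserves [K],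
     exponent [n.+1] covers exponent [n]. *)
  move=> gP n; have [h Kh <-] := gP n.+1 (ltn0Sn n).
  by exists (phi_hat h); [apply: fK; exists h|rewrite iterSr].
Qed.
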